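(* Let $n$ be a fixed odd number and let $\ell,k\ge0$ be integers. Then for any $x=x_0+\underline{x}\in\mathbb{R}^{n+1}$, $$P_\ell^n(x)\odot_{GCK}P_k^n(x)=P_{k+\ell}^n(x).$$
   Context: $\mathbb{R}_n$ is the real Clifford algebra generated by $e_1,\dots,e_n$ with $e_\ell e_m+e_me_\ell=0$ for $\ell\ne m$ and $e_\ell^2=-1$. A point $(x_0,\dots,x_n)\in\mathbb{R}^{n+1}$ is identified with the paravector $x=x_0+\underline{x}$, $\underline{x}=\sum_{\ell=1}^n x_\ell e_\ell$; $\bar x=x_0-\underline{x}$. The Clifford-Appell polynomials are $$P_k^n(x):=\sum_{s=0}^k T_s^k(n)\,x^{k-s}\bar x^{s},\qquad T_s^k(n):=\binom{k}{s}\frac{\left(\frac{n+1}{2}\right)_{k-s}\left(\frac{n-1}{2}\right)_s}{(n)_k},$$ where $(a)_0=1$ and $(a)_s=a(a+1)\cdots(a+s-1)$ for $s>0$; they are axially monogenic. A function $f$ on an axially symmetric slice domain (e.g. $\mathbb{R}^{n+1}$) is axially monogenic if it is $C^1$, satisfies $\left(\partial_{x_0}+\sum_{i=1}^n e_i\partial_{x_i}\right)f=0$, and has the form $f(x_0+\underline{x})=A(x_0,|\underline{x}|)+\frac{\underline{x}}{|\underline{x}|}B(x_0,|\underline{x}|)$ with $\mathbb{R}_n$-valued $A,B$ such that $A$ is even and $B$ is odd in the second variable. For an $\mathbb{R}_n$-valued real-analytic function $f_0$ on an open set of $\mathbb{R}$, $GCK[f_0]$ denotes its generalized CK-extension: the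 unique axially monogenic function (on an axially symmetric slice neighbourhood of the domain of $f_0$) of the form $\sum_{j\ge0}\underline{x}^jf_j(x_0)$ whose restriction to the real line is $f_0$. For axially monogenic $A,B$, the generalized CK-product is $A(x_0,\underline{x})\odot_{GCK}B(x_0,\underline{x}):=GCK[A(x_0,0)\cdot B(x_0,0)]$. *)

(* Defs.v *)
From HB Require Import structures.
From mathcomp Require Import all_boot all_order all_algebra.
From mathcomp Require Import all_classical all_reals all_analysis.
From mathcomp Require Import ring.

Set Implicit Arguments.
Unset Strict Implicit.
Unset Printing Implicit Defensive.

Import Order.TTheory GRing.Theory Num.Theory.
Import numFieldNormedType.Exports.

Local Open Scope classical_set_scope.
Local Open Scope ring_scope.

(* The product of basis blades e_A = e_(a_1) ... e_(a_p), a_1 < ... < a_p, is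
   e_A e_B = blade_sign A B * e_(A symdiff B): every pair (i, j) in A x B with
   j < i costs a transposition, and every i = j costs e_i ^ 2 = -1. *)
Section Blades.
Context (R : realType) (n : nat).
Implicit Types A B C : {set 'I_n}.

Definition symdiff A B : {set 'I_n} := [set i | (i \in A) (+) (i \in B)]%SET.

Definition blade_sign A B : R :=
  \prod_(i in A) \prod_(j in B) (if (j <= i)%N then -1 else 1).

Lemma symdiffA : associative symdiff.
Proof. by move=> A B C; apply/setP => i; rewrite !inE addbA. Qed.

Lemma symdiffC : commutative symdiff.
Proof. by move=> A B; apply/setP => i; rewrite !inE addbC. Qed.

Lemma symdiff0 : right_id finset.set0 symdiff.
Proof. by move=> A; apply/setP => i; rewrite !inE addbF. Qed.

Lemma sym0diff : left_id finset.set0 symdiff.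
Proof. by move=> A; rewrite symdiffC symdiff0. Qed.

Lemma symdiffK A : involutive (symdiff A).
Proof. by move=> B; apply/setP => i; rewrite !inE addKb. Qed.

Lemma prod_symdiff (g : 'I_n -> R) A B : (forall i, g i * g i = 1) ->
  \prod_(i in symdiff A B) g i = \prod_(i in A) g i * \prod_(i in B) g i.
Proof.
move=> gg; rewrite big_mkcond [in RHS]big_mkcond /=.
rewrite [X in _ = _ * X]big_mkcond -big_split /=.
apply: eq_bigr => i _; rewrite inE.
by case: (i \in A); case: (i \in B); rewrite /= ?mulr1 ?mul1r ?gg.
Qed.

Lemma blade_sign_symdiffl A B C :
  blade_sign (symdiff A B) C = blade_sign A C * blade_sign B C.
Proof.
rewrite /blade_sign prod_symdiff // => i.
rewrite -big_split big1 //= => j _.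
by case: ifP; rewrite ?mulr1 // mulrNN mulr1.
Qed.

Lemma blade_sign_symdiffr A B C :
  blade_sign A (symdiff B C) = blade_sign A B * blade_sign A C.
Proof.
rewrite /blade_sign -big_split; apply: eq_bigr => i _ /=.
by rewrite prod_symdiff // => j; case: ifP; rewrite ?mulr1 // mulrNN mulr1.
Qed.

Lemma blade_sign0l A : blade_sign finset.set0 A = 1.
Proof. by rewrite /blade_sign big_set0. Qed.

Lemma blade_sign0r A : blade_sign A finset.set0 = 1.
Proof. by rewrite /blade_sign big1 // => i _; rewrite big_set0. Qed.

End Blades.

(* The Clifford algebra R_n: coefficients indexed by blades, with the topology
   and (sup) norm of the underlying finite-dimensional space. *)
Definition clifford (R : realType) (n : nat) : Type :=
  'rV[R]_#|{: {set 'I_n}}|.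

Section CliffordAlgebra.
Context (R : realType) (n : nat).
Notation Cl := (clifford R n).

HB.instance Definition _ := NormedModule.copy Cl 'rV[R]_#|{: {set 'I_n}}|.

Implicit Types (a b c : Cl) (A B C : {set 'I_n}).

Definition clcoef a A : R := (a : 'rV[R]__) 0 (enum_rank A).

Definition clrow (g : {set 'I_n} -> R) : Cl := \row_i g (enum_val i).

Definition blade A : Cl := clrow (fun B => (B == A)%:R).

Definition clmul a b : Cl := clrow (fun C =>
  \sum_A blade_sign R A (symdiff A C) * (clcoef a A * clcoef b (symdiff A C))).

Lemma clrowE g A : clcoef (clrow g) A = g A.
Proof. by rewrite /clcoef mxE enum_rankK. Qed.

Lemma clP a b : (forall A, clcoef a A = clcoef b A) -> a = b.
Proof.
move=> ab; apply/rowP => i.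
by have := ab (enum_val i); rewrite /clcoef enum_valK.
Qed.

Lemma clcoefD a b A : clcoef (a + b) A = clcoef a A + clcoef b A.
Proof. by rewrite /clcoef mxE. Qed.

Lemma clcoefZ (k : R) a A : clcoef (k *: a) A = k * clcoef a A.
Proof. by rewrite /clcoef mxE. Qed.

Lemma clmulA : associative clmul.
Proof.
move=> a b c; apply: clP => D; rewrite !clrowE.
under eq_bigr => A _.
  rewrite clrowE (reindex_inj (inv_inj (symdiffK A))) /= mulr_sumr mulr_sumr.
  over.
rewrite exchange_big /=; apply: eq_bigr => C _.
rewrite clrowE mulr_suml mulr_sumr; apply: eq_bigr => A _.
have -> : symdiff (symdiff A C) (symdiff A D) = symdiff C D.
  by rewrite (symdiffC A C) -symdiffA symdiffK.
have -> : blade_sign R (symdiff A C) (symdiff C D) =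
    blade_sign R A C * blade_sign R A D * blade_sign R C (symdiff C D).
  by rewrite blade_sign_symdiffl blade_sign_symdiffr.
rewrite !blade_sign_symdiffr.
have ss (X Y : {set 'I_n}) : blade_sign R X Y * blade_sign R X Y = 1.
  rewrite -blade_sign_symdiffr; have -> : symdiff Y Y = finset.set0.
    by apply/setP => i; rewrite !inE addbb.
  exact: blade_sign0r.
set sAA := blade_sign R A A; set sAC := blade_sign R A C.
set sAD := blade_sign R A D; set sCC := blade_sign R C C.
set sCD := blade_sign R C D.
set x := clcoef a A; set y := clcoef b _; set z := clcoef c _.
transitivity ((sAD * sAD) * (sAA * sAC * sCC * sCD * x * y * z)); last first.
  by rewrite ss; ring.
by ring.
Qed.

Lemma clmul1l : left_id (blade finset.set0) clmul.
Proof.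
move=> a; apply: clP => C; rewrite clrowE (bigD1 finset.set0) //= clrowE eqxx.
rewrite sym0diff blade_sign0l !mul1r big1 ?addr0 // => A /negPf A0.
by rewrite clrowE A0 mul0r mulr0.
Qed.

Lemma clmul1r : right_id (blade finset.set0) clmul.
Proof.
move=> a; apply: clP => C; rewrite clrowE (bigD1 C) //= clrowE.
have -> : symdiff C C = finset.set0 by apply/setP => i; rewrite !inE addbb.
rewrite eqxx blade_sign0r mul1r mulr1 big1 ?addr0 // => A /negPf AC.
rewrite clrowE; case: eqP => [e|_]; last by rewrite !mulr0.
by move: AC; rewrite -(symdiffK A C) e symdiff0 eqxx.
Qed.

Lemma clmulDl : left_distributive clmul +%R.
Proof.
move=> a b c; apply: clP => C; rewrite clcoefD !clrowE -big_split /=.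
by apply: eq_bigr => A _; rewrite clcoefD mulrDl mulrDr.
Qed.

Lemma clmulDr : right_distributive clmul +%R.
Proof.
move=> a b c; apply: clP => C; rewrite clcoefD !clrowE -big_split /=.
by apply: eq_bigr => A _; rewrite clcoefD !mulrDr.
Qed.

Lemma cl1_neq0 : blade finset.set0 != 0 :> Cl.
Proof.
apply/eqP => /(congr1 (fun a : Cl => clcoef a finset.set0)).
by rewrite clrowE eqxx /clcoef mxE => /eqP; rewrite oner_eq0.
Qed.

HB.instance Definition _ := GRing.Zmodule_isNzRing.Build Cl
  clmulA clmul1l clmul1r clmulDl clmulDr cl1_neq0.

Lemma clscaleAl (k : R) a b : k *: (a * b) = (k *: a) * b.
Proof.
apply: clP => C; rewrite clcoefZ !clrowE mulr_sumr.
by apply: eq_bigr => A _; rewrite clcoefZ; ring.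
Qed.

HB.instance Definition _ := GRing.Lmodule_isLalgebra.Build R Cl clscaleAl.

Lemma clscaleAr (k : R) a b : k *: (a * b) = a * (k *: b).
Proof.
apply: clP => C; rewrite clcoefZ !clrowE mulr_sumr.
by apply: eq_bigr => A _; rewrite clcoefZ; ring.
Qed.

HB.instance Definition _ := GRing.Lalgebra_isAlgebra.Build R Cl clscaleAr.

Lemma bladeM A B : blade A * blade B = blade_sign R A B *: blade (symdiff A B).
Proof.
apply: clP => C; rewrite clcoefZ !clrowE (bigD1 A) //= !clrowE eqxx mul1r.
rewrite big1 ?addr0 => [|D /negPf DA]; last by rewrite clrowE DA mul0r mulr0.
have -> : (symdiff A C == B) = (C == symdiff A B).
  by apply/eqP/eqP => [<-|->]; rewrite symdiffK.
by case: eqP => [->|]; rewrite ?symdiffK ?mulr0.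
Qed.

Definition gen (i : 'I_n) : Cl := blade [set i]%SET.

Lemma gen_sqr i : gen i * gen i = -1.
Proof.
rewrite bladeM /blade_sign !big_set1 leqnn.
have -> : symdiff [set i]%SET [set i]%SET = finset.set0.
  by apply/setP => j; rewrite !inE addbb.
by rewrite scaleN1r.
Qed.

Lemma gen_anticomm i j : i != j -> gen i * gen j + gen j * gen i = 0.
Proof.
move=> ij; rewrite !bladeM symdiffC -scalerDl /blade_sign !big_set1.
by case: ltngtP ij => [||/val_inj->]; rewrite ?eqxx ?addNr ?subrr ?scale0r.
Qed.

End CliffordAlgebra.

Section Paravectors.
Context (R : realType) (n : nat).
Notation Cl := (clifford R n).

(* A point of R^(n+1) is a row vector; its entry 0 is x_0 and its entry
   lift ord0 i is the coordinate along gen i. *)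
Implicit Types (x : 'rV[R]_n.+1) (w : 'rV[R]_n) (t r : R).

Definition pt t w : 'rV[R]_n.+1 := \row_i oapp (w 0) t (unlift ord0 i).

Definition repart x : R := x 0 ord0.

Definition vecpart x : 'rV[R]_n := \row_i x 0 (lift ord0 i).

Lemma repart_pt t w : repart (pt t w) = t.
Proof. by rewrite /repart mxE unlift_none. Qed.

Lemma vecpart_pt t w : vecpart (pt t w) = w.
Proof. by apply/rowP => i; rewrite !mxE liftK. Qed.

Definition enorm w : R := Num.sqrt (\sum_(i < n) w 0 i ^+ 2).

Definition vec w : Cl := \sum_(i < n) w 0 i *: gen R i.

Definition uvec x : Cl := vec (vecpart x).

Definition para x : Cl := (repart x)%:A + uvec x.

Definition para_conj x : Cl := (repart x)%:A - uvec x.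

Definition poch (a : R) (s : nat) : R := \prod_(i < s) (a + i%:R).

Definition appell_coef (k s : nat) : R :=
  'C(k, s)%:R * (poch ((n%:R + 1) / 2) (k - s) * poch ((n%:R - 1) / 2) s
                 / poch n%:R k).

Definition appell (k : nat) x : Cl :=
  \sum_(s < k.+1) appell_coef k s *: (para x ^+ (k - s) * para_conj x ^+ s).

Definition real_trace (U : set 'rV[R]_n.+1) : set R := [set t | U (pt t 0)].

Definition axially_symmetric (U : set 'rV[R]_n.+1) :=
  forall u v w, enorm v = enorm w -> U (pt u v) -> U (pt u w).

Definition slice_domain (U : set 'rV[R]_n.+1) :=
  [/\ open U, connected U, real_trace U !=set0 &
      forall I : 'rV[R]_n, enorm I = 1 ->
        connected [set z : R * R | U (pt z.1 (z.2 *: I))]].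

Definition C1_on (U : set 'rV[R]_n.+1) (F : 'rV[R]_n.+1 -> Cl) :=
  forall (i : 'I_n.+1) x, U x ->
    derivable F x (delta_mx 0 i) /\
    {for x, continuous (fun y => 'D_(delta_mx 0 i) F y)}.

Definition cauchy_riemann (F : 'rV[R]_n.+1 -> Cl) x : Cl :=
  'D_(delta_mx 0 ord0) F x +
  \sum_(i < n) gen R i * 'D_(delta_mx 0 (lift ord0 i)) F x.

(* At real points (enorm = 0) the quotient below is 0 since 0^-1 = 0; this is
   harmless because B(x0, 0) = 0 by oddness. *)
Definition axial_form (U : set 'rV[R]_n.+1) (F : 'rV[R]_n.+1 -> Cl) :=
  exists A B : R -> R -> Cl,
    [/\ forall u v, A u (- v) = A u v,
        forall u v, B u (- v) = - B u v &
        forall x, U x -> let r := enorm (vecpart x) in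
          F x = A (repart x) r + (r^-1 *: uvec x) * B (repart x) r].

Definition axially_monogenic (U : set 'rV[R]_n.+1) (F : 'rV[R]_n.+1 -> Cl) :=
  [/\ axially_symmetric U /\ slice_domain U,
      C1_on U F,
      forall x, U x -> cauchy_riemann F x = 0 &
      axial_form U F].

Definition real_analytic_on (D : set R) (f : R -> Cl) :=
  forall a, D a -> exists (c : nat -> Cl),
    \forall t \near a, series (fun j => (t - a) ^+ j *: c j) @ \oo --> f t.

Definition is_GCK (U : set 'rV[R]_n.+1) (f0 : R -> Cl)
    (F : 'rV[R]_n.+1 -> Cl) :=
  [/\ real_analytic_on (real_trace U) f0,
      axially_monogenic U F,
      exists f : nat -> R -> Cl, forall x, U x ->
        series (fun j => uvec x ^+ j * f j (repart x)) @ \oo --> F x &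
      forall t, real_trace U t -> F (pt t 0) = f0 t].

(* The extension to U of f0, a function on the open set real_trace U; only the
   values on U are meaningful, and the value is 0 when there is no extension. *)
Definition GCK (U : set 'rV[R]_n.+1) (f0 : R -> Cl) : 'rV[R]_n.+1 -> Cl :=
  xget (fun=> 0) [set F | is_GCK U f0 F].

Definition GCK_product (U : set 'rV[R]_n.+1) (F G : 'rV[R]_n.+1 -> Cl) :
    'rV[R]_n.+1 -> Cl :=
  GCK U (fun t => F (pt t 0) * G (pt t 0)).

End Paravectors.

(* Main.v *)
Require Import Defs.
From mathcomp Require Import all_boot all_order all_algebra.
From mathcomp Require Import all_classical all_reals all_analysis.
From mathcomp Require Import ring lra.

(* Both sides restrict to [t ^ (k + l)] on the real line, so it suffices that
   [appell (k + l)] is a generalized CK-extension of that monomial and that such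
   extensions are unique.
   Existence: in powers of the vector part, P_k = sum_j d_j x_0^(k-j) v^j with
   w_j d_j = (k - j + 1) d_(j-1), where the Dirac operator maps v^j to
   - w_j v^(j-1); the recursion is the Cauchy-Riemann equation.
   Uniqueness: a difference G of two extensions, restricted to the half plane
   x = u + r e_1, is for each u an entire power series in r, satisfies a
   first-order system relating d_u G to d_r G, and vanishes for r = 0. Wherever
   the coefficients are locally bounded in u, comparing leading orders in r kills
   them one after the other; by Baire's theorem such points are dense, and the
   set where all coefficients vanish is closed. *)

Set Implicit Arguments.
Unset Strict Implicit.
Unset Printing Implicit Defensive.

Import Order.TTheory GRing.Theory Num.Theory.
Import numFieldNormedType.Exports.

Local Open Scope classical_set_scope.
Local Open Scope ring_scope.

(** * Power series and uniqueness for the radial system *)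

Section PowerSeries.
Context {R : realType}.
Implicit Types (c : nat -> R) (r l M : R).

(** The tail beyond index [j] is at most [r ^+ j.+1] in size times a geometric series of ratio
    1/2. *)
Lemma pseries_leading_term c j r l M :
    (forall i, `|c i| * 2 ^+ i <= M) -> (forall i, (i < j)%N -> c i = 0) ->
    `|r| <= 1 -> pseries c r @ \oo --> l ->
  `|l - c j * r ^+ j| <= 2 * M * `|r| ^+ j.+1.
Proof.
move=> cM c0 r1 cl; have M0 : 0 <= M by apply: le_trans (cM 0); rewrite mulr_ge0.
have r0 := normr_ge0 r.
have cMi i : `|c i| <= M * 2^-1 ^+ i.
  by rewrite exprVn ler_pdivlMr ?exprn_gt0.
(* From [m] to [m.+1] the last factor adds [M * 2^-1 ^+ m] times the power of [r], which is what the
   next term may cost. *)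
have part m : `|pseries c r (m + j.+1)%N - c j * r ^+ j| <=
    2 * M * `|r| ^+ j.+1 * (1 - 2^-1 ^+ m).
  elim: m => [|m IHm].
    rewrite add0n expr0 subrr mulr0 /pseries /series /= big_nat_recr //=.
    by rewrite big_nat big1 ?add0r ?subrr ?normr0 // => i /c0->; rewrite mul0r.
  rewrite addSn /pseries /series /= big_nat_recr //= addrAC.
  apply: le_trans (ler_normD _ _) _.
  have -> : 2 * M * `|r| ^+ j.+1 * (1 - 2^-1 ^+ m.+1) =
      2 * M * `|r| ^+ j.+1 * (1 - 2^-1 ^+ m) + M * 2^-1 ^+ m * `|r| ^+ j.+1.
    by rewrite (exprS 2^-1); field.
  apply: lerD; first exact: IHm.
  rewrite normrM normrX exprD mulrA; apply: ler_wpM2r; first exact: exprn_ge0.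
  apply: le_trans (_ : `|c (m + j.+1)%N| * 1 <= _).
    by rewrite ler_wpM2l // exprn_ile1.
  rewrite mulr1; apply: le_trans (cMi _) _; rewrite ler_wpM2l // exprD.
  by rewrite ler_piMr ?exprn_ge0 ?exprn_ile1 // ?invr_ge0 // invf_le1 ?ler1n.
have cvgl : `|pseries c r m - c j * r ^+ j| @[m --> \oo] --> `|l - c j * r ^+ j|.
  by apply: cvg_norm; apply: cvgB => //; exact: cvg_cst.
rewrite -(cvg_lim (@Rhausdorff R) cvgl); apply: limr_le; first exact: cvgP cvgl.
near=> m; have jm : (j.+1 <= m)%N by near: m; exact: nbhs_infty_ge.
have := part (m - j.+1)%N; rewrite subnK // => /le_trans; apply.
by rewrite -[leRHS]mulr1 ler_wpM2l ?mulr_ge0 ?exprn_ge0 ?gerBl ?exprn_ge0.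
Unshelve. all: by end_near. Qed.

Lemma pseries_coef_bound c r : cvgn (pseries c r) ->
  exists M : R, forall i, `|c i * r ^+ i| <= M.
Proof.
move=> /cvg_series_bounded[K [_ Kc]]; exists (K + 1) => i.
by apply: Kc => //; rewrite ltrDl.
Qed.

Lemma cvg_pseries_diffs c : (forall r, cvgn (pseries c r)) ->
  forall r, cvgn (pseries (pseries_diffs c) r).
Proof.
(* In [4 ^ i.+1 = 2 ^ i.+1 * 2 ^ i.+1] one factor absorbs the [i.+1] from differentiation; the other
   yields a geometric majorant. *)
move=> cc r; have [M cM] := pseries_coef_bound (cc (4 * (`|r| + 1))).
have r0 : 0 < `|r| + 1 by rewrite ltr_wpDl.
apply: normed_cvg.
apply: (@series_le_cvg _ _ (geometric M 2^-1)) => [i|i|i|].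
- exact: normr_ge0.
- rewrite /= mulr_ge0 ?exprn_ge0 //.
  exact: le_trans (normr_ge0 _) (cM 0).
- rewrite /geometric /= /pseries_diffs !normrM normr_nat normrX exprVn.
  rewrite ler_pdivlMr ?exprn_gt0 //.
  apply: le_trans (cM i.+1); rewrite normrM normrX normrM normr_nat.
  rewrite (gtr0_norm r0) exprMn.
  have -> : i.+1%:R * `|c i.+1| * `|r| ^+ i * 2 ^+ i =
    `|c i.+1| * ((i.+1%:R * 2 ^+ i) * `|r| ^+ i) by ring.
  apply: ler_wpM2l => //; apply: ler_pM; rewrite ?mulr_ge0 ?exprn_ge0 //.
    rewrite -natrX -natrX -natrM ler_nat.
    have -> : (4 ^ i.+1 = 2 ^ i.+1 * 2 ^ i.+1)%N by rewrite -expnMn.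
    by apply: leq_mul; [exact/ltnW/ltn_expl | rewrite leq_exp2l].
  apply: le_trans (_ : (`|r| + 1) ^+ i <= _).
    by rewrite lerXn2r ?nnegrE // ?lerDl // ltW.
  by rewrite exprS ler_peMl ?exprn_ge0 ?lerDr // ltW.
- apply: is_cvg_geometric_series.
  by rewrite ger0_norm ?invr_ge0 // invf_lt1 ?ltr1n.
Qed.

Lemma is_derive_pseries c (f : R -> R) r : (forall s, pseries c s @ \oo --> f s) ->
  is_derive r 1 f (limn (pseries (pseries_diffs c) r)).
Proof.
move=> cf; have cc s : cvgn (pseries c s) by exact: cvgP (cf s).
have -> : f = fun s => limn (pseries c s).
  by apply/funext => s; apply/esym/cvg_lim.
(* Termwise differentiation asks for convergence of the series and of its first two formal
   derivatives at a radius beyond that of [r]. *)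
apply: (@pseries_snd_diffs _ _ (`|r| + 1)) => //; try exact: cvg_pseries_diffs.
  by apply: cvg_pseries_diffs; exact: cvg_pseries_diffs.
by rewrite [ltRHS]gtr0_norm ?ltrDl // ltr_wpDl.
Qed.

End PowerSeries.

Section PowerSeriesFamilies.
Context {R : realType}.

(* Convergence of the sums, together with a uniform bound on the coefficients,
   forces convergence of each coefficient: divide by [r ^+ j] and let [r] tend
   to 0. *)
Lemma cvg_pseries_coef {T : Type} (F : set_system T) {FF : Filter F}
    (d : T -> nat -> R) (D : T -> R -> R) (M : R) :
    (\forall u \near F, forall i, `|d u i| * 2 ^+ i <= M) ->
    (forall u r, 0 < r <= 1 -> pseries (d u) r @ \oo --> D u r) ->
    (forall r, 0 < r <= 1 -> D u r @[u --> F] --> 0) ->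
  forall j, d u j @[u --> F] --> 0.
Proof.
move=> dM dD D0; elim/ltn_ind => j IHj.
(* The coefficients below [j] are removed; they tend to 0 by induction, so the truncated sums [D']
   still do. *)
pose d' u i := if (i < j)%N then 0 else d u i.
pose D' u r := D u r - \sum_(i < j) d u i * r ^+ i.
have d'D u r : 0 < r <= 1 -> pseries (d' u) r @ \oo --> D' u r.
  move=> r01; apply: cvg_trans (cvgB (dD u r r01) (cvg_cst _)).
  apply: near_eq_cvg; near=> m; have jm : (j <= m)%N.
    by near: m; exact: nbhs_infty_ge.
  rewrite -[RHS]/(pseries (d' u) r m) -[LHS]/(pseries (d u) r m - _).
  rewrite -(big_mkord xpredT (fun i => d u i * r ^+ i)) /pseries /series /=.
  rewrite (big_cat_nat (leq0n j) jm) //= addrAC subrr add0r.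
  rewrite (big_cat_nat (leq0n j) jm) //= (_ : \sum_(0 <= i < j) _ = 0).
    rewrite add0r big_nat [RHS]big_nat; apply: eq_bigr => i /andP[ji _].
    by rewrite /d' ltnNge ji.
  by rewrite big_nat big1 // => i /andP[_ ij]; rewrite /d' ij mul0r.
have D'0 r : 0 < r <= 1 -> D' u r @[u --> F] --> 0.
  move=> r01; rewrite [0 in X in _ --> X](_ : 0 = 0 - \sum_(i < j) 0 * r ^+ i).
    apply: cvgB; first exact: D0.
    apply: cvg_big => [|i _]; first exact: add_continuous.
    by apply: cvgMr_tmp; exact: IHj.
  by rewrite big1 ?subr0 // => i _; rewrite mul0r.
(* This [r] is at most 1 and gives [2 * M * r <= e / 2]; the other half of [e] pays for [D' u r]. *)
apply/cvgrPdist_le => e e0; pose r := e / (4 * `|M| + e).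
have den0 : 0 < 4 * `|M| + e by rewrite ltr_wpDl // mulr_ge0.
have r0 : 0 < r by rewrite divr_gt0.
have r1 : r <= 1 by rewrite ler_pdivrMr // mul1r lerDr mulr_ge0.
have r01 : 0 < r <= 1 by rewrite r0 r1.
have rj0 : 0 < r ^+ j by rewrite exprn_gt0.
have /cvgrPdist_le/(_ (e / 2 * r ^+ j)) := D'0 r r01.
move=> /(_ ltac:(by rewrite mulr_gt0 ?divr_gt0)) D'e.
near=> u.
have bM : forall i, `|d u i| * 2 ^+ i <= M by near: u.
have b1 : `|D' u r - d' u j * r ^+ j| <= 2 * M * `|r| ^+ j.+1.
  apply: pseries_leading_term (d'D u r r01).
  - move=> i; rewrite /d'; case: ifP => // _; rewrite normr0 mul0r.
    by apply: le_trans (bM 0); rewrite mulr_ge0.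
  - by move=> i ij; rewrite /d' ij.
  - by rewrite gtr0_norm.
have b2 : `|0 - D' u r| <= e / 2 * r ^+ j by near: u; exact: D'e.
move: b1; rewrite /d' ltnn (gtr0_norm r0) => b1.
rewrite sub0r normrN in b2; rewrite sub0r normrN -(ler_pM2r rj0).
rewrite -[X in _ * X <= _](gtr0_norm rj0) -normrM.
have -> : d u j * r ^+ j = D' u r - (D' u r - d u j * r ^+ j).
  by rewrite opprB addrC subrK.
apply: le_trans (ler_normB _ _) _; apply: le_trans (lerD b2 b1) _.
have Mr : 2 * M * r <= e / 2.
  rewrite /r mulrA ler_pdivrMr //.
  have := ler_norm M; have := normr_ge0 M; nra.
rewrite exprS; nra.
Unshelve. all: by end_near. Qed.

End PowerSeriesFamilies.

(** * Leading order of the radial operator on a power series *)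

Section DerivativeLeadingTerm.
Context {R : realType}.

(* The eigenvalue of [f |-> f' + p (f(r) - f(-r)) / (2 r)] on [r ^+ j]. *)
Definition radial_weight (p : R) (j : nat) : R := j%:R + p *+ odd j.

Lemma radial_weight_ge1 (p : R) j : 0 <= p -> 1 <= radial_weight p j.+1.
Proof.
move=> p0; rewrite /radial_weight -[leLHS]addr0; apply: lerD; last exact: mulrn_wge0.
by rewrite ler1n.
Qed.

(** The bound with [4 ^+ i] survives differentiation as a bound with [2 ^+ i], so
    [pseries_leading_term] applies to [f] and to its derivative. The derivative contributes [j.+1]
    to the weight, the odd quotient contributes [p] for odd [j.+1]. *)
Lemma radial_derivative_leading_term (p M r : R) (c : nat -> R) (f : R -> R) j :
    0 <= p -> (forall i, `|c i| * 4 ^+ i <= M) ->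
    (forall i, (i < j.+1)%N -> c i = 0) ->
    (forall s, pseries c s @ \oo --> f s) -> 0 < r <= 1 ->
  `|'D_1 f r + p * ((f r - f (- r)) / (2 * r)) -
      radial_weight p j.+1 * c j.+1 * r ^+ j| <= (2 + 2 * p) * M * r ^+ j.+1.
Proof.
move=> p0 cM c0 cf /andP[r0 r1].
have nr1 : `|r| <= 1 by rewrite gtr0_norm.
have two4 i : (2 : R) ^+ i <= 4 ^+ i by rewrite lerXn2r ?nnegrE // ler_nat.
have cM2 i : `|c i| * 2 ^+ i <= M by apply: le_trans (cM i); rewrite ler_wpM2l.
have M0 : 0 <= M by apply: le_trans (cM2 0); rewrite mulr_ge0.
have -> : 'D_1 f r = limn (pseries (pseries_diffs c) r).
  by have := is_derive_pseries r cf => /@derive_val.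
set f' := limn _.
have f'E : `|f' - j.+1%:R * c j.+1 * r ^+ j| <= 2 * M * r ^+ j.+1.
  rewrite -[X in X ^+ j.+1](gtr0_norm r0).
  apply: (@pseries_leading_term _ (pseries_diffs c)) => //.
  - move=> i; rewrite /pseries_diffs normrM normr_nat; apply: le_trans (cM i.+1).
    rewrite mulrAC mulrC; apply: ler_wpM2l => //.
    rewrite -!natrX -natrM ler_nat.
    have -> : (4 ^ i.+1 = 2 ^ i.+1 * 2 ^ i.+1)%N by rewrite -expnMn.
    by apply: leq_mul; [exact/ltnW/ltn_expl | rewrite leq_exp2l].
  - by move=> i ij; rewrite /pseries_diffs c0 ?mulr0.
  - by apply: cvg_pseries_diffs => s; exact: cvgP (cf s).
have fE : `|f r - c j.+1 * r ^+ j.+1| <= 2 * M * r ^+ j.+2.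
  rewrite -[X in X ^+ j.+2](gtr0_norm r0).
  exact: pseries_leading_term.
have fNE : `|f (- r) - c j.+1 * (- r) ^+ j.+1| <= 2 * M * r ^+ j.+2.
  rewrite -[X in X ^+ j.+2](gtr0_norm r0) -[X in X ^+ j.+2]normrN.
  by apply: pseries_leading_term; rewrite ?normrN.
(* Dividing by [2 * r] merges the two errors of order [j.+2] into one of order [j.+1]. *)
have dE : `|(f r - f (- r)) / (2 * r) - c j.+1 *+ odd j.+1 * r ^+ j| <=
    2 * M * r ^+ j.+1.
  have r20 : 0 < 2 * r by rewrite mulr_gt0.
  rewrite -(ler_pM2r r20) -[X in _ * X <= _](gtr0_norm r20) -normrM mulrBl.
  rewrite divfK ?gt_eqF //.
  have -> : c j.+1 *+ odd j.+1 * r ^+ j * (2 * r) =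
      c j.+1 * r ^+ j.+1 - c j.+1 * (- r) ^+ j.+1.
    rewrite exprNn -signr_odd (exprS r) /=.
    by case: (odd j); rewrite /= ?expr1 ?expr0 ?mulr1n ?mulr0n; ring.
  have -> : f r - f (- r) - (c j.+1 * r ^+ j.+1 - c j.+1 * (- r) ^+ j.+1) =
    (f r - c j.+1 * r ^+ j.+1) - (f (- r) - c j.+1 * (- r) ^+ j.+1) by ring.
  apply: le_trans (ler_normB _ _) _; apply: le_trans (lerD fE fNE) _.
  by rewrite le_eqVlt (exprS _ j.+1); apply/orP; left; apply/eqP; ring.
have -> : f' + p * ((f r - f (- r)) / (2 * r)) - radial_weight p j.+1 * c j.+1 * r ^+ j
  = (f' - j.+1%:R * c j.+1 * r ^+ j) +
    p * ((f r - f (- r)) / (2 * r) - c j.+1 *+ odd j.+1 * r ^+ j).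
  by rewrite /radial_weight; case: (odd j.+1); rewrite ?mulr1n ?mulr0n; ring.
apply: le_trans (ler_normD _ _) _; rewrite normrM (ger0_norm p0).
apply: le_trans (lerD f'E (ler_wpM2l p0 dE)) _.
by rewrite le_eqVlt; apply/orP; left; apply/eqP; ring.
Qed.

End DerivativeLeadingTerm.

(** * Uniqueness for a first-order system in [u] and [r] with zero data at [r = 0] *)

Section RadialUniqueness.
Context {R : realType} {I : finType}.
Variables (H : I -> R -> R -> R) (h : I -> nat -> R -> R).
Variables (p : R) (sg : I -> R) (tau : I -> I).
Hypothesis p0 : 0 <= p.
Hypothesis sg1 : forall c, `|sg c| = 1.
Hypothesis tau_surj : forall d, exists c, tau c = d.
Hypothesis Hh : forall c u r, pseries ((h c)^~ u) r @ \oo --> H c u r.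
Hypothesis H0 : forall c u, H c u 0 = 0.
Hypothesis Hu : forall c u r, 0 < r -> is_derive u (1 : R) ((H c)^~ r)
  (sg c * ('D_1 (H (tau c) u) r +
           p * ((H (tau c) u r - H (tau c) u (- r)) / (2 * r)))).

(** The series converge at [r = 4], so the sets [E N] exhaust the line; [E 0] is the common zero set
    of all coefficients. *)
Let E (N : nat) := [set u : R | forall c j, `|h c j u| * 4 ^+ j <= N%:R].

Let H_continuous c r : 0 < r -> continuous ((H c)^~ r).
Proof.
move=> r0 u; apply/differentiable_continuous/derivable1_diffP.
by case: (Hu c u r0).
Qed.

(** For fixed [r > 0] the sums are continuous in [u], and on [E N] the coefficients are uniformly
    bounded, so [cvg_pseries_coef] applies to the differences. A general filter covers both limits
    along [E N] and full neighbourhoods. *)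
Let h_cvg (F : set_system R) {FF : Filter F} (N : nat) u0 :
    F --> nbhs u0 -> F (E N) -> forall c j, h c j u @[u --> F] --> h c j u0.
Proof.
move=> Fu0 FE c j.
have cvg1 : cvgn (pseries ((h c)^~ u0) 4) by apply: cvgP; exact: Hh.
have [M0 hM0] := pseries_coef_bound cvg1.
apply/subr_cvg0; move: j.
apply: (@cvg_pseries_coef _ _ F _ (fun u i => h c i u - h c i u0)
  (fun u r => H c u r - H c u0 r) (N%:R + M0)).
- near=> u => i; have uE : E N u by near: u.
  apply: le_trans (_ : (`|h c i u| + `|h c i u0|) * 4 ^+ i <= _).
    by apply: ler_pM; rewrite ?ler_normB // lerXn2r ?nnegrE // ler_nat.
  rewrite mulrDl lerD //; apply: le_trans (hM0 i).
  by rewrite normrM normrX normr_nat.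
- move=> u r _; apply: cvg_trans (cvgB (@Hh c u r) (@Hh c u0 r)).
  apply: near_eq_cvg; near=> m; rewrite /pseries /series /=.
  by rewrite -[LHS]sumrB; apply: eq_bigr => i _; rewrite mulrBl.
- move=> r /andP[r0 _]; apply/subr_cvg0.
  exact: cvg_trans (cvg_app _ Fu0) (@H_continuous c r r0 u0).
Unshelve. all: by end_near. Qed.

Let closed_E N : closed (E N).
Proof.
move=> u0 cl c j.
have FF : ProperFilter (within (E N) (nbhs u0)) by exact: within_nbhs_proper.
have cv : h c j u @[u --> within (E N) (nbhs u0)] --> h c j u0.
  by apply: (@h_cvg _ _ N); [exact: cvg_within | exact: withinT].
have cv4 : `|h c j u| * 4 ^+ j @[u --> within (E N) (nbhs u0)] -->
    `|h c j u0| * 4 ^+ j by apply: cvgMr_tmp; exact: cvg_norm.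
rewrite -(cvg_lim (@Rhausdorff R) cv4); apply: limr_le; first exact: cvgP cv4.
by apply: filterS (withinT (E N) _) => u uE; exact: uE.
Qed.

(* If all coefficients below [j] vanish on [Q], then the [u]-increments of [H]
   are O(r ^ j), while the derivative of [H] in [u] is of exact order r ^ (j - 1)
   where the [j]-th coefficient is nonzero: the mean value theorem forbids this. *)
Let E0_open N (Q : set R) : open Q -> Q `<=` E N -> Q `<=` E 0.
Proof.
move=> oQ QE; suff h0 j : forall c u, Q u -> h c j u = 0.
  by move=> u Qu c j; rewrite h0 // normr0 mul0r.
elim/ltn_ind: j => j IHj d u0 Qu0.
have hN c u : Q u -> forall i, `|h c i u| * 4 ^+ i <= N%:R.
  by move=> Qu i; exact: QE.
have hN2 c u : Q u -> forall i, `|h c i u| * 2 ^+ i <= N%:R.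
  move=> Qu i; apply: le_trans (hN c u Qu i); rewrite ler_wpM2l //.
  by rewrite lerXn2r ?nnegrE // ler_nat.
case: j IHj => [_|j IHj].
  (* At [r = 0] the error bound is 0, so the constant coefficient equals [H d u0 0], which
     vanishes. *)
  have := @pseries_leading_term _ ((h d)^~ u0) 0 0 (H d u0 0) N%:R.
  move=> /(_ (hN2 d u0 Qu0)) /(_ ltac:(by [])) /(_ ltac:(by rewrite normr0)).
  move=> /(_ (@Hh _ _ _)); rewrite H0 sub0r expr0 mulr1 normrN normr0 expr1 mulr0.
  by rewrite normr_le0 => /eqP.
(* The equation for the [u]-derivative of [H c] is the one whose right-hand side involves [H d]. *)
have [c tauc] := tau_surj d; apply/eqP; apply: contraT => hd0.
pose e := `|h d j.+1 u0| / 2.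
have e0 : 0 < e by rewrite divr_gt0 // normr_gt0.
have nQ : nbhs u0 Q by exact: open_nbhs_nbhs.
have cont : h d j.+1 u @[u --> u0] --> h d j.+1 u0.
  apply: (@h_cvg _ _ N) => //; exact: filterS QE nQ.
have /cvgrPdist_le/(_ e e0) near_e := cont.
have [k /= k0 kQ] := filterI nQ near_e.
pose a := u0; pose b := u0 + k / 2.
have ab : a < b by rewrite ltrDl divr_gt0.
have inQ x : a <= x <= b -> Q x /\ `|h d j.+1 u0 - h d j.+1 x| <= e.
  move=> /andP[ax xb]; apply: kQ; rewrite /= distrC ger0_norm ?subr_ge0 //.
  rewrite ltrBlDr addrC; apply: le_lt_trans xb _.
  by rewrite ltrD2l ltr_pdivrMr // ltr_pMr // ltr1n.
have ba0 : 0 < b - a by rewrite subr_gt0.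
(* The first summand is the error in [radial_derivative_leading_term]; the second comes from the
   increment of [H c] between [a] and [b], where each end value costs [3 * N%:R * r ^+ j.+1]. *)
pose C := (2 + 2 * p) * N%:R + 6 * N%:R / (b - a).
have small r : 0 < r <= 1 -> e <= r * C.
  move=> /andP[r0 r1].
  have r01 : 0 < r <= 1 by rewrite r0.
  pose df x := sg c * ('D_1 (H d x) r + p * ((H d x r - H d x (- r)) / (2 * r))).
  (* The intermediate point depends on [r], which is why [inQ] controls the coefficient on the whole
     interval. *)
  have [||x xab HE] := @MVT _ ((H c)^~ r) df a b ab.
  - by move=> x _; rewrite /df -tauc; exact: Hu.
  - exact/continuous_subspaceT/H_continuous.
  have {}xab : a <= x <= b.
    by move: xab; rewrite in_itv /= => /andP[/ltW-> /ltW->].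
  have [Qx hx] := inQ x xab.
  have rj0 : 0 < r ^+ j by rewrite exprn_gt0.
  have Hb y : Q y -> `|H c y r| <= 3 * N%:R * r ^+ j.+1.
    move=> Qy.
    have b1 : `|H c y r - h c j.+1 y * r ^+ j.+1| <= 2 * N%:R * `|r| ^+ j.+2.
      apply: (@pseries_leading_term _ ((h c)^~ y)) => //; first exact: hN2.
      - by move=> i ij; rewrite IHj.
      - by rewrite gtr0_norm.
    have b2 : `|h c j.+1 y * r ^+ j.+1| <= N%:R * r ^+ j.+1.
      rewrite normrM normrX (gtr0_norm r0).
      apply: ler_wpM2r; first by rewrite exprn_ge0 // ltW.
      apply: le_trans (hN2 c y Qy j.+1); rewrite ler_peMr // exprn_ege1 //.
      by rewrite ler1n.
    rewrite -[H c y r](subrK (h c j.+1 y * r ^+ j.+1)).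
    apply: le_trans (ler_normD _ _) _; apply: le_trans (lerD b1 b2) _.
    have -> : 3 * N%:R * r ^+ j.+1 = 2 * N%:R * r ^+ j.+1 + N%:R * r ^+ j.+1.
      by ring.
    rewrite lerD2r ler_wpM2l ?mulr_ge0 // gtr0_norm // exprS.
    by rewrite ler_piMl ?exprn_ge0 // ltW.
  have Qa : Q a by [].
  have Qb : Q b by have [|] := inQ b; rewrite ?lexx ?(ltW ab).
  have dfb : `|df x| * (b - a) <= 6 * N%:R * r ^+ j.+1.
    rewrite -[X in _ * X <= _](gtr0_norm ba0) -normrM -HE.
    apply: le_trans (ler_normB _ _) _.
    apply: le_trans (lerD (Hb b Qb) (Hb a Qa)) _.
    by rewrite le_eqVlt; apply/orP; left; apply/eqP; ring.
  rewrite /df normrM sg1 mul1r in dfb.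
  have lead := @radial_derivative_leading_term _ p N%:R r ((h d)^~ x) (H d x) j
    p0 (hN d x Qx) (fun i ij => IHj i ij d x Qx) (@Hh d x) r01.
  set Y := _ + _ in dfb; rewrite -/Y in lead.
  have hx_ge : e <= `|h d j.+1 x|.
    have := ler_normD (h d j.+1 u0 - h d j.+1 x) (h d j.+1 x).
    rewrite subrK; move: hx.
    have : `|h d j.+1 u0| = 2 * e by rewrite /e mulrC divfK.
    lra.
  have w1 := radial_weight_ge1 j p0.
  have lower : e * r ^+ j <= `|Y| + (2 + 2 * p) * N%:R * r ^+ j.+1.
    apply: le_trans (_ : `|radial_weight p j.+1 * h d j.+1 x * r ^+ j| <= _).
      rewrite !normrM (gtr0_norm rj0); apply: ler_wpM2r; first exact: ltW.
      apply: le_trans hx_ge _; rewrite ler_peMl //.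
      by apply: le_trans w1 _; exact: ler_norm.
    set X := _ * _ in lead *; have := ler_normB Y (Y - X).
    rewrite subKr => /le_trans; apply.
    by rewrite lerD2l.
  rewrite -(ler_pM2r rj0); apply: le_trans lower _.
  have : `|Y| <= 6 * N%:R * r ^+ j.+1 / (b - a) by rewrite ler_pdivlMr.
  rewrite (exprS r j); rewrite /C; set z := (b - a)^-1; lra.
have C0 : 0 <= C.
  by apply: addr_ge0; [rewrite mulr_ge0 ?addr_ge0 ?mulr_ge0 |
    rewrite divr_ge0 ?mulr_ge0 // ltW].
have den0 : 0 < C + e by rewrite ltr_wpDl.
have den1 : 0 < 2 * (C + e) by rewrite mulr_gt0.
(* For this [r] the product [r * C] is at most [e / 2], contradicting [small]. *)
have r0 : 0 < e / (2 * (C + e)) by rewrite divr_gt0.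
have r1 : e / (2 * (C + e)) <= 1 by rewrite ler_pdivrMr // mul1r; lra.
have := small (e / (2 * (C + e))); rewrite r0 r1 => /(_ isT).
rewrite mulrAC ler_pdivlMr //.
by have := mulr_ge0 (ltW e0) C0; have := mulr_gt0 e0 e0; lra.
Qed.

(* Baire's theorem produces an open set on which the coefficients are uniformly
   bounded, hence zero, inside any open set missing the closed set [E 0]. *)
Lemma radial_system_uniqueness c j u : h c j u = 0.
Proof.
suff /(_ c j) : E 0 u by rewrite mulr0n pmulr_lle0 ?exprn_gt0 // normr_le0 => /eqP.
apply: contrapT => nu.
pose V N := ~` (E N `&` closure (~` E 0)).
have cE (N : nat) : open (V N) /\ dense (V N).
  split.
    by apply: closed_openC; apply: closedI; [apply: closed_E | apply: closed_closure].
  (* An open set missing [V N] would lie in [E N], hence in [E 0] by [E0_open], yet also in the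
     closure of the complement of [E 0]. *)
  move=> Q [q Qq] oQ; apply: contrapT => QV0.
  have QV : Q `<=` E N `&` closure (~` E 0).
    by move=> v Qv; apply: contrapT => nv; apply: QV0; exists v.
  have QE0 : Q `<=` E 0 by apply: (@E0_open N) => // v /QV[].
  have [_ clq] := QV q Qq.
  by have [v [nv Qv]] := clq Q (open_nbhs_nbhs (conj oQ Qq)); apply: nv; exact: QE0.
have [v [nv Vv]] : (~` E 0 `&` \bigcap_i V i) !=set0.
  apply: (Baire cE); first by exists u.
  exact/closed_openC/closed_E.
have bnd d : exists N : nat, forall i, `|h d i v| * 4 ^+ i <= N%:R.
  have cvg1 : cvgn (pseries ((h d)^~ v) 4) by apply: cvgP; exact: Hh.
  have [M hM] := pseries_coef_bound cvg1.
  exists (Num.truncn M).+1 => i; apply: le_trans (_ : M <= _).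
    by have := hM i; rewrite normrM normrX normr_nat.
  exact/ltW/truncnS_gt.
have [N bN] := choice bnd.
(* Summing over the finite index type gives one bound for all [d], so [v] lies in some [E N]
   although it belongs to every [V N]. *)
apply: (Vv (\sum_d N d)%N) => //; split; last exact: subset_closure.
move=> d i; apply: le_trans (bN d i) _; rewrite ler_nat.
by rewrite (bigD1 d) //= leq_addr.
Qed.

End RadialUniqueness.

(** * Axially monogenic functions vanishing on the real line *)

Section CliffordCoefficients.
Context {R : realType} {n : nat}.
Notation Cl := (clifford R n).
Implicit Types (a b : Cl) (C : {set 'I_n}).

Lemma clcoefB a b C : clcoef (a - b) C = clcoef a C - clcoef b C.
Proof. by rewrite /clcoef !mxE. Qed.

Lemma clcoefN a C : clcoef (- a) C = - clcoef a C.
Proof. by rewrite /clcoef mxE. Qed.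

Lemma clcoef0 C : clcoef (0 : Cl) C = 0.
Proof. by rewrite /clcoef mxE. Qed.

Lemma clcoef_sum (J : Type) (s : seq J) (P : pred J) (F : J -> Cl) C :
  clcoef (\sum_(i <- s | P i) F i) C = \sum_(i <- s | P i) clcoef (F i) C.
Proof. by rewrite /clcoef summxE. Qed.

Lemma clcoef_continuous C : continuous (fun a : Cl => clcoef a C).
Proof. exact: coord_continuous. Qed.

Lemma cvg_clcoef (T : Type) (F : set_system T) {FF : Filter F} (g : T -> Cl) a C :
  g x @[x --> F] --> a -> clcoef (g x) C @[x --> F] --> clcoef a C.
Proof. by move=> ga; apply: cvg_comp ga (@clcoef_continuous C a). Qed.

Lemma is_derive_clcoef (V : normedModType R) (F : V -> Cl) x v dF C :
  is_derive x v F dF -> is_derive x v (fun y => clcoef (F y) C) (clcoef dF C).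
Proof.
move=> [dF1 <-].
have cv : h^-1 *: (clcoef (F (h *: v + x)) C - clcoef (F x) C) @[h --> 0^']
    --> clcoef ('D_v F x) C.
  under eq_cvg do rewrite -clcoefB -[_ *: _]/(_ * _) -clcoefZ.
  exact: cvg_clcoef.
by split; [exact: cvgP cv | exact: cvg_lim cv].
Qed.

Lemma blade_sign_normr (A B : {set 'I_n}) : `|blade_sign R A B| = 1.
Proof.
rewrite /blade_sign normr_prod big1 // => i _; rewrite normr_prod big1 // => j _.
by case: ifP; rewrite ?normrN normr1.
Qed.

(** Left multiplication by a generator permutes the blades up to sign; this supplies [tau] and [sg]
    of the radial system. *)
Lemma clcoef_genM i a C : clcoef (gen R i * a) C =
  blade_sign R [set i]%SET (symdiff [set i]%SET C) *
  clcoef a (symdiff [set i]%SET C).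
Proof.
rewrite [gen R i * a]/(clmul _ _) clrowE (bigD1 [set i]%SET) //= /gen clrowE eqxx.
by rewrite mul1r big1 ?addr0 // => A /negPf Ai; rewrite clrowE Ai mul0r mulr0.
Qed.

(** Serves to cancel the power of the generator in front of the coefficient functions of the
    expansion. *)
Lemma gen_expr_inv i j : (- gen R i) ^+ j * gen R i ^+ j = 1 :> Cl.
Proof.
elim: j => [|j IHj]; first by rewrite !expr0 mulr1.
rewrite exprSr exprS mulrA -(mulrA _ (- gen R i)) mulNr gen_sqr opprK mulr1.
exact: IHj.
Qed.

End CliffordCoefficients.

(** * Derivatives along lines and symmetric difference quotients *)

Section LineDerivatives.
Context {R : realType} {V W : normedModType R}.

(** The difference quotients on both sides coincide, so a directional derivative suffices. *)
Lemma is_derive_line (F : V -> W) (g : R -> V) (v : V) (a : R) :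
    (forall h, g (h + a) = h *: v + g a) -> derivable F (g a) v ->
  is_derive a (1 : R) (F \o g) ('D_v F (g a)).
Proof.
move=> gv dF.
have cv : h^-1 *: ((F \o g) (h *: 1 + a) - (F \o g) a) @[h --> 0^']
    --> 'D_v F (g a).
  by under eq_cvg do rewrite /= [_ *: 1]mulr1 gv; exact: dF.
by split; [exact: cvgP cv | exact: cvg_lim cv].
Qed.

End LineDerivatives.

(** Away from 0, [chi] is the symmetric difference quotient of [phi], so its limit at 0 is both [d]
    and [chi 0]. It gives a derivative from antisymmetric differences alone. *)
Lemma derive_symmetric_quotient {R : realType} (phi chi : R -> R) (d : R) :
    is_derive (0 : R) (1 : R) phi d ->
    (forall s, s != 0 -> phi s - phi (- s) = 2 * s * chi s) ->
    {for 0, continuous chi} ->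
  d = chi 0.
Proof.
move=> dphi phiE chi0.
have dphiN : is_derive (0 : R) (1 : R) (fun s => phi (- s)) (- d).
  have dN : is_derive (0 : R) (1 : R) (-%R : R -> R) (- 1) by exact: is_deriveNid.
  have dphi' : is_derive (- 0 : R) (1 : R) phi d by rewrite oppr0.
  by have := is_derive1_comp dphi' dN; rewrite mulrN1.
have dpsi := is_deriveB dphi dphiN; have /@ex_derive dcv := dpsi.
have : 2 * chi h @[h --> 0^'] --> d - - d.
  have <- := @derive_val _ _ _ _ _ _ _ dpsi.
  apply: cvg_trans dcv; apply: near_eq_cvg; near=> h.
  have h0 : h != 0 by near: h; exact: nbhs_dnbhs_neq.
  rewrite /= !fctE /= addr0 [_ *: 1]mulr1 oppr0 subrr subr0 phiE //.
  by rewrite -[_ *: _]/(_ * _) [2 * h]mulrC -mulrA mulKf.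
have chi2 : 2 * chi h @[h --> 0^'] --> 2 * chi 0.
  by apply: cvgMl_tmp; apply: cvg_trans chi0; apply: cvg_app; exact: nbhs_dnbhs.
move=> /(cvg_unique (@Rhausdorff R) chi2); rewrite opprK => e.
by apply: (@mulfI _ 2) => //; rewrite e; ring.
Unshelve. all: by end_near. Qed.

Section Points.
Context {R : realType} {n : nat}.
Implicit Types (t u h : R) (w : 'rV[R]_n) (i : 'I_n).

Lemma ptD t u w w' : pt t w + pt u w' = pt (t + u) (w + w').
Proof. by apply/rowP => j; rewrite !mxE; case: unliftP => [i|] _ /=; rewrite ?mxE. Qed.

Lemma ptZ h t w : h *: pt t w = pt (h * t) (h *: w).
Proof. by apply/rowP => j; rewrite !mxE; case: unliftP => [i|] _ /=; rewrite ?mxE. Qed.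

Lemma delta_pt0 : delta_mx 0 ord0 = pt 1 0 :> 'rV[R]_n.+1.
Proof.
by apply/rowP => j; rewrite !mxE eqxx /=; case: unliftP => [i|] -> /=; rewrite ?mxE.
Qed.

Lemma delta_ptS i : delta_mx 0 (lift ord0 i) = pt 0 (delta_mx 0 i) :> 'rV[R]_n.+1.
Proof.
apply/rowP => j; rewrite !mxE eqxx /=; case: unliftP => [k|] -> //=.
by rewrite !mxE eqxx /= (inj_eq (@lift_inj _ ord0)).
Qed.

Lemma uvec_pt t w : uvec (pt t w) = vec w.
Proof. by rewrite /uvec vecpart_pt. Qed.

Lemma vecD w w' : vec (w + w') = vec w + vec w'.
Proof. by rewrite /vec -big_split; apply: eq_bigr => i _; rewrite mxE scalerDl. Qed.

Lemma vecZ h w : vec (h *: w) = h *: vec w.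
Proof. by rewrite /vec scaler_sumr; apply: eq_bigr => i _; rewrite mxE scalerA. Qed.

Lemma vec_delta i : vec (delta_mx 0 i) = gen R i.
Proof.
rewrite /vec (bigD1 i) //= mxE !eqxx scale1r big1 ?addr0 // => j /negPf ji.
by rewrite mxE eqxx ji scale0r.
Qed.

Lemma vec0 : vec (0 : 'rV[R]_n) = 0.
Proof. by rewrite -(scale0r 0) vecZ scale0r. Qed.

Lemma enorm_delta2 i j r s : i != j ->
  enorm (r *: delta_mx 0 i + s *: delta_mx 0 j : 'rV[R]_n) =
  Num.sqrt (r ^+ 2 + s ^+ 2).
Proof.
move=> /negPf ij; rewrite /enorm (bigD1 i) //= (bigD1 j) /= ?[j == i]eq_sym ?ij //.
rewrite !mxE !eqxx ij [j == i]eq_sym ij /= !mulr1 !mulr0 addr0 add0r.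
rewrite big1 ?addr0 // => k /andP[/negPf ki /negPf kj].
by rewrite !mxE ki kj /= !mulr0 addr0 expr0n.
Qed.

Lemma enorm_delta i r : enorm (r *: delta_mx 0 i : 'rV[R]_n) = `|r|.
Proof.
rewrite /enorm (bigD1 i) //= !mxE !eqxx mulr1 big1 ?addr0 ?sqrtr_sqr //.
by move=> k /negPf ki; rewrite !mxE ki /= mulr0 expr0n.
Qed.

End Points.

(** * Reduction of an axially monogenic function to the plane spanned by 1 and the first
    generator *)

Section AxialUniqueness.
Context {R : realType} {m : nat}.
Notation n := m.+1.
Notation Cl := (clifford R n).
Variable G : 'rV[R]_n.+1 -> Cl.
Hypothesis dG : forall (i : 'I_n.+1) x, derivable G x (delta_mx 0 i).
Hypothesis axG : axial_form setT G.

Let e0 : 'rV[R]_n := delta_mx 0 ord0.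
Let g0 : Cl := gen R ord0.
Let H u r : Cl := G (pt u (r *: e0)).

Let H_is_derive_r u r C : is_derive r (1 : R) (fun s => clcoef (H u s) C)
  (clcoef ('D_(delta_mx 0 (lift ord0 ord0)) G (pt u (r *: e0))) C).
Proof.
apply: is_derive_clcoef; apply: (@is_derive_line _ _ _ G (fun s => pt u (s *: e0))) => // h.
by rewrite delta_ptS ptZ ptD mulr0 add0r scalerDl.
Qed.

Let H_is_derive_u u r C : is_derive u (1 : R) (fun t => clcoef (H t r) C)
  (clcoef ('D_(delta_mx 0 ord0) G (pt u (r *: e0))) C).
Proof.
apply: is_derive_clcoef; apply: (@is_derive_line _ _ _ G (fun t => pt t (r *: e0))) => // h.
by rewrite delta_pt0 ptZ ptD mulr1 scaler0 add0r.
Qed.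

Let H_continuous u C : continuous (fun r => clcoef (H u r) C).
Proof.
move=> r; apply/differentiable_continuous/derivable1_diffP.
by case: (H_is_derive_r u r C).
Qed.

(** Moving along a generator orthogonal to the plane changes the norm only to second order, so the
    derivative is [gen R i] times [B / r]; the two factors [gen R i] then square to -1. *)
Lemma axial_transverse_derive u r (i : 'I_n) : 0 < r -> i != ord0 ->
  gen R i * 'D_(delta_mx 0 (lift ord0 i)) G (pt u (r *: e0)) =
  (2 * r)^-1 *: (g0 * (H u r - H u (- r))).
Proof.
move=> r0 i0; have [A [B [_ _ GAB]]] := axG.
pose rho s := Num.sqrt (r ^+ 2 + s ^+ 2).
have rho_gt0 s : 0 < rho s by rewrite sqrtr_gt0 ltr_wpDr ?sqr_ge0 // exprn_gt0.
have rho0 : rho 0 = r by rewrite /rho expr0n addr0 sqrtr_sqr gtr0_norm.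
(* Between [s] and [- s] the radius is unchanged and the vector part flips, so the difference is
   [2 * g0 * B]. *)
have BE s : 0 < s -> B u s = - g0 * (2^-1 *: (H u s - H u (- s))).
  move=> s0; rewrite /H !GAB // !vecpart_pt !enorm_delta normrN gtr0_norm //.
  rewrite !repart_pt !uvec_pt !vecZ vec_delta !scalerA mulrN mulVf ?gt_eqF //.
  rewrite scale1r scaleN1r [- gen _ _ * B _ _]mulNr opprD opprK addrACA subrr add0r -mulr2n.
  rewrite -(scaler_nat 2 (_ * _)) scalerA mulVf ?pnatr_eq0 // scale1r mulrA mulNr gen_sqr.
  by rewrite opprK mul1r.
(* Both points have norm [rho s], so [A] and the [e0] component cancel. *)
have diffE s : G (pt u (r *: e0 + s *: delta_mx 0 i)) -
    G (pt u (r *: e0 + - s *: delta_mx 0 i)) =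
    (s / rho s) *: (gen R i * (- g0) * (H u (rho s) - H u (- rho s))).
  rewrite !GAB // !vecpart_pt !enorm_delta2 1?eq_sym // sqrrN -/(rho s).
  rewrite !repart_pt !uvec_pt !vecD !vecZ !vec_delta.
  rewrite opprD addrACA subrr add0r -mulrBl -scalerBr opprD addrACA subrr add0r.
  rewrite scaleNr opprK -mulr2n -scaler_nat !scalerA BE //.
  rewrite -!scalerAl -!scalerAr !scalerA mulrA; congr (_ *: _).
  by rewrite -[_ *: s]/(_ * s); field; rewrite gt_eqF.
have DE : 'D_(delta_mx 0 (lift ord0 i)) G (pt u (r *: e0)) =
    (2 * r)^-1 *: (gen R i * (- g0) * (H u r - H u (- r))).
  apply: clP => C.
  pose phi s := clcoef (G (pt u (r *: e0 + s *: delta_mx 0 i))) C.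
  (* Left multiplication by [gen R i * (- g0)] carries coefficient [C2] to coefficient [C] with sign
     [k]. *)
  pose C1 := symdiff [set i]%SET C; pose C2 := symdiff [set ord0]%SET C1.
  pose k := - (blade_sign R [set i]%SET C1 * blade_sign R [set ord0]%SET C2).
  pose chi s := (2 * rho s)^-1 *
    (k * (clcoef (H u (rho s)) C2 - clcoef (H u (- rho s)) C2)).
  have kE X : clcoef (gen R i * (- g0) * X) C = k * clcoef X C2.
    by rewrite mulrN mulNr clcoefN -mulrA !clcoef_genM /k -/C1 -/C2; ring.
  rewrite clcoefZ kE clcoefB -rho0 -/(chi 0).
  apply: (@derive_symmetric_quotient _ phi).
  - have := is_derive_clcoef C (@is_derive_line _ _ _ G
      (fun s => pt u (r *: e0 + s *: delta_mx 0 i)) _ 0 _ (@dG (lift ord0 i) _)).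
    rewrite /= rho0 scale0r addr0; apply => h.
    by rewrite delta_ptS ptZ ptD mulr0 add0r addr0 addrC.
  - move=> s s0; rewrite /phi -clcoefB diffE clcoefZ kE clcoefB /chi.
    by field; rewrite gt_eqF.
  - have crho : {for 0, continuous rho}.
      have c1 : {for 0, continuous (fun s : R => r ^+ 2 + s ^+ 2)}.
        by apply: cvgD; [exact: cvg_cst | exact: exprn_continuous].
      exact: (continuous_comp c1 (@sqrt_continuous R _)).
    have cH : {for 0, continuous (fun s => clcoef (H u (rho s)) C2)}.
      exact: (continuous_comp crho (@H_continuous u C2 _)).
    have cHN : {for 0, continuous (fun s => clcoef (H u (- rho s)) C2)}.
      have crhoN : {for 0, continuous (fun s => - rho s)} by exact: cvgN.
      exact: (continuous_comp crhoN (@H_continuous u C2 _)).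
    apply: cvgM; last by apply: cvgMl_tmp; apply: cvgB.
    apply: cvgV; first by rewrite mulf_neq0 // gt_eqF.
    exact: cvgMl_tmp.
rewrite DE -scalerAr !mulrA gen_sqr; congr (_ *: _).
by rewrite mulN1r opprK.
Qed.

Hypothesis crG : forall x, cauchy_riemann G x = 0.
Variable f : nat -> R -> Cl.
Hypothesis fG : forall x,
  series (fun j => uvec x ^+ j * f j (repart x)) @ \oo --> G x.
Hypothesis G0 : forall t, G (pt t 0) = 0.

(** The [m] transverse directions contribute equal terms, so the system has [p = m]. *)
Let cauchy_riemann_radial u r : 0 < r ->
  'D_(delta_mx 0 ord0) G (pt u (r *: e0)) =
  - (g0 * ('D_(delta_mx 0 (lift ord0 ord0)) G (pt u (r *: e0)) +
           (m%:R / (2 * r)) *: (H u r - H u (- r)))).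
Proof.
move=> r0; have := crG (pt u (r *: e0)); rewrite /cauchy_riemann => /eqP.
rewrite addr_eq0 => /eqP ->; congr (- _); rewrite big_ord_recl mulrDr.
congr (_ + _); rewrite (eq_bigr (fun=> (2 * r)^-1 *: (g0 * (H u r - H u (- r))))).
  by rewrite sumr_const card_ord -scaler_nat scalerA -scalerAr.
by move=> i _; rewrite axial_transverse_derive.
Qed.

Lemma axially_monogenic_uniqueness x : G x = 0.
Proof.
pose Hc (C : {set 'I_n}) u r := clcoef (H u r) C.
(* At [u + r e_1] the [j]-th power of the vector part is [r ^+ j *: g0 ^+ j], so these are the
   Taylor coefficients in [r]. *)
pose hc (C : {set 'I_n}) j u := clcoef (g0 ^+ j * f j u) C.
have Hh C u r : pseries ((hc C)^~ u) r @ \oo --> Hc C u r.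
  apply: cvg_trans (cvg_clcoef (C := C) (@fG (pt u (r *: e0)))).
  apply: near_eq_cvg; near=> N; rewrite /pseries /series /= clcoef_sum.
  apply: eq_bigr => j _; rewrite uvec_pt repart_pt vecZ vec_delta exprZn.
  by rewrite -scalerAl clcoefZ mulrC.
have Hu C u r : 0 < r -> is_derive u (1 : R) ((Hc C)^~ r)
    (- blade_sign R [set ord0]%SET (symdiff [set ord0]%SET C) *
     ('D_1 (Hc (symdiff [set ord0]%SET C) u) r +
      m%:R * ((Hc (symdiff [set ord0]%SET C) u r -
               Hc (symdiff [set ord0]%SET C) u (- r)) / (2 * r)))).
  move=> r0; apply: is_derive_eq (H_is_derive_u u r C) _.
  rewrite cauchy_riemann_radial // clcoefN clcoef_genM mulNr; congr (- (_ * _)).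
  rewrite clcoefD clcoefZ clcoefB; congr (_ + _); last by rewrite mulrAC mulrA.
  by have /@derive_val := H_is_derive_r u r (symdiff [set ord0]%SET C).
have h0 C j u : hc C j u = 0.
  apply: (@radial_system_uniqueness R _ Hc hc m%:R
    (fun C => - blade_sign R [set ord0]%SET (symdiff [set ord0]%SET C))
    (fun C => symdiff [set ord0]%SET C)) => //.
  - by move=> D; rewrite normrN blade_sign_normr.
  - by move=> D; exists (symdiff [set ord0]%SET D); rewrite symdiffK.
  - by move=> D v; rewrite /Hc /H scale0r G0 clcoef0.
(* The functions [f j] depend on the real part only: vanishing on one half plane forces them, and
   hence [G], to vanish everywhere. *)
have f0 j u : f j u = 0.
  rewrite -[f j u]mul1r -(gen_expr_inv ord0 j) -mulrA.
  rewrite (_ : _ ^+ j * f j u = 0) ?mulr0 //.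
  by apply: clP => C; rewrite clcoef0; exact: h0.
apply/esym/(cvg_unique _ _ (@fG x)); first exact: norm_hausdorff.
rewrite (_ : series _ = cst 0); first exact: cvg_cst.
by apply/funext => N; rewrite /series /= big1 // => j _; rewrite f0 mulr0.
Unshelve. all: by end_near. Qed.

End AxialUniqueness.

(** * The Clifford-Appell polynomials in powers of the vector part *)

Section AppellCoefficients.
Context {R : realType}.
Implicit Types (a b : R) (k s j : nat).

Lemma poch0 a : poch a 0 = 1.
Proof. by rewrite /poch big_ord0. Qed.

Lemma pochSr a s : poch a s.+1 = poch a s * (a + s%:R).
Proof. by rewrite /poch big_ord_recr. Qed.

Lemma pochSl a s : poch a s.+1 = a * poch (a + 1) s.
Proof.
rewrite /poch big_ord_recl addr0; congr (_ * _); apply: eq_bigr => i _ /=.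
by rewrite /bump /= natrD addrA.
Qed.

Lemma poch_gt0 a s : 0 < a -> 0 < poch a s.
Proof. by move=> a0; apply: prodr_gt0 => i _; rewrite ltr_wpDr. Qed.

(** The Chu-Vandermonde identity. Pascal's rule splits the sum, and [a + b + k] is
    [(a + (k - s)) + (b + s)]. *)
Lemma poch_vandermonde a b k :
  \sum_(s < k.+1) 'C(k, s)%:R * (poch a (k - s) * poch b s) = poch (a + b) k.
Proof.
elim: k => [|k IHk]; first by rewrite big_ord1 !poch0 !mulr1 bin0.
rewrite pochSr -IHk mulr_suml big_ord_recl bin0 subn0 poch0.
have -> : \sum_(i < k.+1) 'C(k.+1, lift ord0 i)%:R *
    (poch a (k.+1 - lift ord0 i) * poch b (lift ord0 i)) =
    \sum_(i < k) 'C(k, i.+1)%:R * (poch a (k - i) * poch b i.+1) +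
    \sum_(i < k.+1) 'C(k, i)%:R * (poch a (k - i) * poch b i.+1) :> R.
  under eq_bigr do rewrite /= /bump /= add1n subSS binS natrD mulrDl.
  by rewrite big_split /= big_ord_recr /= bin_small // mul0r addr0.
rewrite addrA.
have -> : 1%:R * (poch a k.+1 * 1) +
    \sum_(i < k) 'C(k, i.+1)%:R * (poch a (k - i) * poch b i.+1) =
    \sum_(i < k.+1) 'C(k, i)%:R * (poch a (k.+1 - i) * poch b i) :> R.
  by rewrite big_ord_recl bin0 subn0 poch0.
rewrite -big_split /=; apply: eq_bigr => -[s /= sk] _.
rewrite ltnS in sk; rewrite subSn // !pochSr natrB //; ring.
Qed.

Variable n : nat.

Lemma sum_appell_coef k : (0 < n)%N -> \sum_(s < k.+1) appell_coef R n k s = 1.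
Proof.
move=> n0; rewrite /appell_coef; under eq_bigr do rewrite mulrA.
rewrite -mulr_suml poch_vandermonde.
have -> : (n%:R + 1) / 2 + (n%:R - 1) / 2 = n%:R :> R by field.
by rewrite divff // gt_eqF // poch_gt0 // ltr0n.
Qed.

Lemma appell_coef_small k s : (k < s)%N -> appell_coef R n k s = 0.
Proof. by move=> ks; rewrite /appell_coef bin_small // mul0r. Qed.

(** The reflection [s -> k - s] exchanges the parameters [m + 1] and [m] of the two rising
    factorials, which are related by [m * poch (m + 1) s = poch m s * (m + s)]. *)
Lemma appell_coef_rec k s : (s <= k)%N ->
  s.+1%:R * appell_coef R n k s.+1 - s%:R * appell_coef R n k s =
  (n%:R - 1) / 2 * (appell_coef R n k s - appell_coef R n k (k - s)).
Proof.
move=> sk; rewrite /appell_coef.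
have -> : (n%:R + 1) / 2 = (n%:R - 1) / 2 + 1 :> R by field.
set m := (n%:R - 1) / 2; set z := (poch n%:R k)^-1; rewrite bin_sub // subKn //.
have binE : s.+1%:R * 'C(k, s.+1)%:R = (k - s)%:R * 'C(k, s)%:R :> R.
  by rewrite -!natrM mul_bin_left.
rewrite (mulrA s.+1%:R) binE.
have mP : m * poch (m + 1) s = poch m s * (m + s%:R) by rewrite -pochSl pochSr.
move: sk; rewrite leq_eqVlt => /orP[/eqP <-|sk].
  rewrite subnn !poch0 mul0r mul0r sub0r.
  have -> : m * ('C(s, s)%:R * (1 * poch m s * z) -
      'C(s, s)%:R * (poch (m + 1) s * 1 * z)) =
      'C(s, s)%:R * (m * poch m s - m * poch (m + 1) s) * z by ring.
  by rewrite mP; ring.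
have -> : (k - s = (k - s).-1.+1)%N by rewrite prednK // subn_gt0.
have -> : (k - s.+1 = (k - s).-1)%N by rewrite subnS.
move: (k - s).-1 => q; rewrite (pochSr (m + 1)) (pochSl _ q) (pochSr m s).
have -> : m * ('C(k, s)%:R * (poch (m + 1) q * (m + 1 + q%:R) * poch m s * z) -
     'C(k, s)%:R * (poch (m + 1) s * (m * poch (m + 1) q) * z)) =
  m * 'C(k, s)%:R * (poch (m + 1) q * (m + 1 + q%:R) * poch m s * z) -
     m * 'C(k, s)%:R * ((m * poch (m + 1) s) * poch (m + 1) q * z) by ring.
rewrite mP -[q.+1]addn1 natrD; ring.
Qed.

(* [appell] as a polynomial in [uvec x / repart x]. *)
Definition appell_poly k : {poly R} :=
  \sum_(s < k.+1) appell_coef R n k s *: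
    ((1 + 'X) ^+ (k - s) * (1 - 'X) ^+ s).

Lemma appell_poly_coef0 k : (0 < n)%N -> (appell_poly k)`_0 = 1.
Proof.
move=> n0; rewrite -[RHS](sum_appell_coef k) // /appell_poly coef_sum.
apply: eq_bigr => s _; rewrite coefZ -horner_coef0 !hornerE /=.
by rewrite ?(addr0, subr0) !expr1n !mulr1.
Qed.

Lemma coef_comp_polyNX (p : {poly R}) j : (p \Po - 'X)`_j = (-1) ^+ j * p`_j.
Proof.
elim/poly_ind: p j => [|p c IHp] j; first by rewrite comp_poly0 coef0 mulr0.
rewrite comp_polyD comp_polyM comp_polyX comp_polyC mulrN !coefD coefN !coefC.
rewrite !coefMX; case: j => [|j] /=; first by rewrite oppr0 expr0 mul1r.
by rewrite !addr0 IHp exprS mulN1r mulNr.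
Qed.

(** The operator [P * p' - k * p] sends [P ^+ (k - s) * M ^+ s] to [- 2 * s] times
    [P ^+ (k - s) * M ^+ s.-1]. Multiplying by [2 * X = P - M] shifts indices, and [X -> - X] swaps
    [P] and [M], so the claim becomes [appell_coef_rec]. *)
Lemma appell_poly_ode k :
  'X * ((1 + 'X) * (appell_poly k)^`() - k%:R *: appell_poly k) =
  - ((n%:R - 1) / 2) *: (appell_poly k - (appell_poly k \Po - 'X)).
Proof.
set P := 1 + 'X; set M : {poly R} := 1 - 'X; set T := appell_coef R n k.
set m := (n%:R - 1) / 2.
have dP : P^`() = 1 by rewrite /P derivD derivC derivX add0r.
have dM : M^`() = - 1 by rewrite /M derivB derivC derivX sub0r.
have lhs : P * (appell_poly k)^`() - k%:R *: appell_poly k =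
    - 2 *: \sum_(s < k.+1) (s%:R * T s) *: (P ^+ (k - s) * M ^+ s.-1).
  rewrite /appell_poly raddf_sum /= mulr_sumr scaler_sumr -sumrB scaler_sumr.
  apply: eq_bigr => -[s /= sk] _; rewrite derivZ derivM !deriv_exp dP dM.
  rewrite ltnS in sk; have -> : k%:R = (k - s)%:R + s%:R :> R by rewrite -natrD subnK.
  move: (k - s)%N => q; set t := T s.
  have e1 : P * (P ^+ q.-1 *+ q) = P ^+ q *+ q.
    by case: q => [|q]; rewrite ?mulr0n ?mulr0 // mulrnAr -exprS.
  have e2 : M * (M ^+ s.-1 *+ s) = M ^+ s *+ s.
    by case: {sk t}s => [|s]; rewrite ?mulr0n ?mulr0 // mulrnAr -exprS.
  rewrite mul1r mulN1r mulNrn mulrN -scalerAr mulrDr mulrA e1 mulrN.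
  have -> : (q%:R + s%:R) *: (t *: (P ^+ q * M ^+ s)) =
      t *: (P ^+ q *+ q * M ^+ s + P ^+ q * (M ^+ s *+ s)).
    rewrite scalerA mulrC -scalerA scalerDl !scaler_nat.
    by rewrite mulrnAl mulrnAr.
  have -> : (s%:R * t) *: (P ^+ q * M ^+ s.-1) =
      t *: (P ^+ q * (M ^+ s.-1 *+ s)).
    by rewrite mulrC -scalerA scaler_nat mulrnAr.
  rewrite -scalerBr [RHS]scalerA [_ * t]mulrC -[RHS]scalerA; congr (_ *: _).
  rewrite -e2; move: (M ^+ s.-1 *+ s) (P ^+ q *+ q * M ^+ s) (P ^+ q) => B C A.
  rewrite scaleNr scaler_nat /P /M; ring.
have flip : appell_poly k \Po - 'X =
    \sum_(s < k.+1) T (k - s)%N *: (P ^+ (k - s) * M ^+ s).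
  rewrite /appell_poly raddf_sum /= (reindex_inj rev_ord_inj) /=.
  apply: eq_bigr => -[s /= sk] _; rewrite subSS comp_polyZ comp_polyM.
  rewrite ltnS in sk; rewrite subKn // !(rmorphXn (comp_poly (- 'X))) /=.
  by rewrite comp_polyD comp_polyB comp_polyX comp_polyC opprK [M ^+ _ * _]mulrC.
have shift : ('X *+ 2) * \sum_(s < k.+1) (s%:R * T s) *: (P ^+ (k - s) * M ^+ s.-1) =
    m *: (appell_poly k - (appell_poly k \Po - 'X)).
  have -> : 'X *+ 2 = P - M :> {poly R} by rewrite /P /M; ring.
  rewrite mulrBl flip /appell_poly -sumrB scaler_sumr.
  have -> : P * (\sum_(s < k.+1) (s%:R * T s) *: (P ^+ (k - s) * M ^+ s.-1)) =
      \sum_(s < k.+1) (s.+1%:R * T s.+1) *: (P ^+ (k - s) * M ^+ s).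
    rewrite big_ord_recl mul0r scale0r add0r big_ord_recr /=.
    rewrite [T k.+1]appell_coef_small // mulr0 scale0r addr0 mulr_sumr.
    apply: eq_bigr => -[s /= sk] _; rewrite -scalerAr [P * _]mulrA -exprS.
    by rewrite subnSK.
  rewrite mulr_sumr -sumrB; apply: eq_bigr => -[s /= sk] _; rewrite ltnS in sk.
  have -> : M * ((s%:R * T s) *: (P ^+ (k - s) * M ^+ s.-1)) =
      (s%:R * T s) *: (P ^+ (k - s) * M ^+ s).
    case: s sk => [|s] sk; first by rewrite mul0r !scale0r mulr0.
    by rewrite -scalerAr [M * _]mulrCA -exprS.
  by rewrite -!scalerBl scalerA appell_coef_rec.
by rewrite lhs -scalerAr scaleNr [RHS]scaleNr -shift mulrnAl (scaler_nat 2).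
Qed.

(** Coefficient [j.+1] of [appell_poly_ode]: the difference with the reflected polynomial keeps odd
    degrees only, hence the parity in the weight. *)
Lemma appell_poly_coefS k j :
  radial_weight (n%:R - 1) j.+1 * (appell_poly k)`_j.+1 =
  (k%:R - j%:R) * (appell_poly k)`_j.
Proof.
have /(congr1 (fun p : {poly R} => p`_j.+1)) := appell_poly_ode k.
rewrite coefXM /= coefB coefZ mulrDl mul1r coefD coefXM !coef_deriv coefZ coefB.
rewrite coef_comp_polyNX -signr_odd /radial_weight.
set d := appell_poly k.
have -> : (if j == 0%N then 0 else d`_j.-1.+1 *+ j.-1.+1) = d`_j *+ j.
  by case: j.
rewrite -(mulr_natr d`_j) -(mulr_natr d`_j.+1).
by case: (odd _) => /=; rewrite ?expr1 ?expr0 ?mulr1n ?mulr0n; lra.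
Qed.

End AppellCoefficients.

(** * Homogenization and powers of the vector part *)

Section AppellExpansion.
Context {R : realType} {n : nat}.
Notation Cl := (clifford R n).
Implicit Types (x : 'rV[R]_n.+1) (w : 'rV[R]_n) (p : {poly R}) (t : R) (v : Cl).

(** Turns the linear factors [1 + 'X] and [1 - 'X] into [para] and [para_conj]. *)
Definition homogenize (k : nat) p t v : Cl :=
  \sum_(j < k.+1) (p`_j * t ^+ (k - j)) *: v ^+ j.

Lemma homogenizeM (k : nat) (c : R) p t v : (size p <= k.+1)%N ->
  homogenize k.+1 ((1 + c *: 'X) * p) t v = (t%:A + c *: v) * homogenize k p t v.
Proof.
move=> sp; rewrite /homogenize [RHS]mulrDl mulrDl mul1r.
under eq_bigr do rewrite coefD -scalerAl coefZ coefXM mulrDl scalerDl.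
rewrite big_split /=; congr (_ + _).
  (* The size bound makes the coefficient of degree [k.+1] vanish; the homogenization of degree [k]
     would drop it. *)
  rewrite big_ord_recr /= nth_default // mul0r scale0r addr0 mulr_sumr.
  apply: eq_bigr => -[j /= jk] _; rewrite ltnS in jk.
  by rewrite -scalerAl mul1r scalerA subSn // exprS mulrCA.
rewrite big_ord_recl /= mulr0 mul0r scale0r add0r mulr_sumr.
apply: eq_bigr => -[j /= jk] _; rewrite /bump /= add1n subSS.
rewrite -[RHS]scalerAr -[in RHS]scalerAl scalerA -exprS add0n.
by congr (_ *: _); ring.
Qed.

Lemma size_appell_factor (a b : nat) :
  (size ((1 + 'X) ^+ a * (1 - 'X) ^+ b : {poly R})%R <= (a + b).+1)%N.
Proof.
have sP (c : R) e : (size ((1 + c *: 'X) ^+ e : {poly R})%R <= e.+1)%N.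
  apply: leq_trans (size_poly_exp_leq _ _) _; rewrite ltnS.
  rewrite -[leqRHS]mul1n leq_mul2r; apply/orP; right.
  rewrite -subn1 leq_subLR; apply: leq_trans (size_polyD _ _) _.
  rewrite geq_max size_poly1 /=.
  by apply: leq_trans (size_scale_leq _ _) _; rewrite size_polyX.
apply: leq_trans (size_polyMleq _ _) _.
have := leq_add (sP 1 a) (sP (- 1) b); rewrite scale1r scaleN1r => h.
rewrite -subn1 leq_subLR; apply: leq_trans h _.
by rewrite addSn addnS add1n.
Qed.

Lemma homogenize_factor (a b : nat) x :
  homogenize (a + b) ((1 + 'X) ^+ a * (1 - 'X) ^+ b) (repart x) (uvec x) =
  para x ^+ a * para_conj x ^+ b.
Proof.
have PE : 1 + 'X = 1 + 1 *: 'X :> {poly R} by rewrite scale1r.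
have ME : 1 - 'X = 1 + (- 1) *: 'X :> {poly R} by rewrite scaleN1r.
elim: a => [|a IHa].
  elim: b => [|b IHb].
    by rewrite /homogenize big_ord1 !expr0 !mulr1 coef1 scale1r.
  rewrite !expr0 !mul1r exprS add0n {1}ME homogenizeM.
    by rewrite scaleN1r exprS -/(para_conj x); move: IHb; rewrite add0n expr0 !mul1r => ->.
  by have := size_appell_factor 0 b; rewrite expr0 mul1r.
rewrite !exprS -!mulrA {1}PE addSn homogenizeM; first by rewrite scale1r IHa.
exact: size_appell_factor.
Qed.

Lemma appell_expansion (k : nat) x : appell k x =
  \sum_(j < k.+1) ((appell_poly n k)`_j * repart x ^+ (k - j)) *: uvec x ^+ j.
Proof.
rewrite /appell (eq_bigr (fun s : 'I_k.+1 => appell_coef R n k s *: homogenize k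
  ((1 + 'X) ^+ (k - s) * (1 - 'X) ^+ s) (repart x) (uvec x))).
  rewrite /homogenize; under eq_bigr do rewrite scaler_sumr.
  rewrite exchange_big; apply: eq_bigr => j _ /=.
  rewrite /appell_poly coef_sum mulr_suml scaler_suml; apply: eq_bigr => s _.
  by rewrite coefZ scalerA mulrA.
by move=> [s /= sk] _; rewrite -homogenize_factor subnK.
Qed.

Definition sqnorm w : R := \sum_(i < n) w 0 i ^+ 2.

Lemma enorm_sqr w : enorm w ^+ 2 = sqnorm w.
Proof. by rewrite sqr_sqrtr // sumr_ge0 // => i _; exact: sqr_ge0. Qed.

(** Averaging the double sum with its transpose cancels the off-diagonal terms by
    anticommutation. *)
Lemma vec_sqr w : vec w * vec w = (- sqnorm w)%:A.
Proof.
have vv : vec w * vec w =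
    \sum_i \sum_j (w 0 i * w 0 j) *: (gen R i * gen R j).
  rewrite /vec mulr_suml; apply: eq_bigr => i _; rewrite mulr_sumr.
  by apply: eq_bigr => j _; rewrite -scalerAl -scalerAr scalerA.
have vv' : vec w * vec w =
    \sum_i \sum_j (w 0 i * w 0 j) *: (gen R j * gen R i).
  rewrite vv exchange_big; apply: eq_bigr => i _; apply: eq_bigr => j _.
  by rewrite mulrC.
have : 2 *: (vec w * vec w) = 2 *: (- sqnorm w)%:A.
  rewrite scaler_nat mulr2n {1}vv vv' -big_split scalerA mulrN scaleNr.
  rewrite mulr_sumr scaler_suml -sumrN; apply: eq_bigr => i _ /=.
  rewrite -big_split (bigD1 i) //= big1 ?addr0 => [|j ji].
    by rewrite gen_sqr -scalerDl scalerN expr2 mulr_natl mulr2n.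
  by rewrite -scalerDr gen_anticomm ?scaler0 // eq_sym.
by move/(scalerI (_ : 2 != 0)); apply.
Qed.

Lemma vec_expr w (j : nat) :
  vec w ^+ j = (- sqnorm w) ^+ j./2 *: (if odd j then vec w else 1).
Proof.
rewrite -{1}(odd_double_half j) addnC exprD -mul2n exprM expr2 vec_sqr exprZn expr1n.
by rewrite -scalerAl mul1r; case: (odd j).
Qed.

End AppellExpansion.

(** * The Clifford-Appell polynomials are generalized CK-extensions *)

Section ScaleDerivative.
Context {R : realType} {V W : normedModType R}.

Lemma is_derive_scale (phi : V -> R) (g : V -> W) x v dphi dg :
  is_derive x v phi dphi -> is_derive x v g dg ->
  is_derive x v (fun y => phi y *: g y) (dphi *: g x + phi x *: dg).
Proof.
move=> [dp <-] [dgx <-].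
have line0 : h *: v + x @[h --> 0^'] --> x.
  rewrite -[X in _ --> X]add0r -(scale0r v); apply: cvgD; last exact: cvg_cst.
  by apply: cvgZr_tmp; exact: nbhs_dnbhs.
(* Differentiability along [v] gives continuity along that line: the increment is [h] times a
   convergent quotient. *)
have gline : g (h *: v + x) @[h --> 0^'] --> g x.
  have : h *: (h^-1 *: (g (h *: v + x) - g x)) + g x @[h --> (0 : R)^'] --> g x.
    rewrite -[X in _ --> X]add0r -(scale0r ('D_v g x)); apply: cvgD; last exact: cvg_cst.
    by apply: cvgZ; [exact: nbhs_dnbhs | exact: dgx].
  apply: cvg_trans; apply: near_eq_cvg; near=> h.
  have h0 : h != 0 by near: h; exact: nbhs_dnbhs_neq.
  by rewrite scalerA divff // scale1r subrK.
have cv : h^-1 *: (phi (h *: v + x) *: g (h *: v + x) - phi x *: g x) @[h --> 0^']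
    --> 'D_v phi x *: g x + phi x *: 'D_v g x.
  have -> : (fun h => h^-1 *: (phi (h *: v + x) *: g (h *: v + x) - phi x *: g x)) =
     (fun h => (h^-1 *: (phi (h *: v + x) - phi x)) *: g (h *: v + x) +
               phi x *: (h^-1 *: (g (h *: v + x) - g x))).
    apply/funext => h; rewrite -[h^-1 *: (_ - _) in RHS]/(_ * _) -scalerA.
    rewrite [phi x *: (h^-1 *: _)]scalerA [phi x * h^-1]mulrC.
    rewrite -[(h^-1 * phi x) *: _]scalerA -scalerDr; congr (_ *: _).
    by rewrite scalerBl scalerBr addrA subrK.
  apply: cvgD; first by apply: cvgZ => //; exact: dp.
  by apply: cvgZl_tmp; exact: dgx.
by split; [exact: cvgP cv | exact: cvg_lim cv].
Unshelve. all: by end_near. Qed.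

Lemma mulr_continuous (f g : V -> R) : continuous f -> continuous g ->
  continuous (fun x => f x * g x).
Proof. by move=> cf cg x; exact: cvgM (cf x) (cg x). Qed.

Lemma scaler_continuous_fun (f : V -> R) (g : V -> W) : continuous f ->
  continuous g -> continuous (fun x => f x *: g x).
Proof. by move=> cf cg x; exact: cvgZ (cf x) (cg x). Qed.

Lemma expr_continuous_fun (f : V -> R) (e : nat) : continuous f ->
  continuous (fun x => f x ^+ e).
Proof.
move=> cf x; have cfx := cf x.
exact: (continuous_comp cfx (@exprn_continuous R e _)).
Qed.

End ScaleDerivative.

(** * Derivatives of the powers of the vector part *)

Section AppellDerivatives.
Context {R : realType} {n : nat}.
Notation Cl := (clifford R n).
Implicit Types (x y : 'rV[R]_n.+1) (i : 'I_n).

Lemma is_derive_coord x y (j : 'I_n.+1) :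
  is_derive x y (fun z : 'rV[R]_n.+1 => z 0 j) (y 0 j).
Proof.
have cv : h^-1 *: ((h *: y + x) 0 j - x 0 j) @[h --> 0^'] --> y 0 j.
  apply: cvg_near_cst; near=> h.
  have h0 : h != 0 by near: h; exact: nbhs_dnbhs_neq.
  by rewrite !mxE addrK -[_ *: _]/(_ * _) mulKf.
by split; [exact: cvgP cv | exact: cvg_lim cv].
Unshelve. all: by end_near. Qed.

Lemma is_derive_repart x y : is_derive x y (@repart R n) (repart y).
Proof. exact: is_derive_coord. Qed.

Lemma uvecE : @uvec R n = \sum_(i < n)
  (fun x => x 0 (lift ord0 i) *: gen R i : Cl).
Proof.
by apply/funext => x; rewrite /uvec /vec fct_sumE; apply: eq_bigr => i _; rewrite mxE.
Qed.

Lemma is_derive_uvec x y : is_derive x y (@uvec R n) (uvec y).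
Proof.
have -> : uvec y = \sum_i y 0 (lift ord0 i) *: gen R i.
  by apply: eq_bigr => i _; rewrite mxE.
rewrite uvecE; apply: is_derive_sum => i.
apply: is_derive_eq (is_derive_scale (is_derive_coord x y (lift ord0 i))
  (is_derive_cst (gen R i : Cl) x y)) _.
by rewrite scaler0 addr0.
Qed.

Lemma repart_continuous : continuous (@repart R n).
Proof. exact: coord_continuous. Qed.

Lemma uvec_continuous : continuous (@uvec R n).
Proof.
have -> : @uvec R n = fun x => \sum_i x 0 (lift ord0 i) *: gen R i.
  by rewrite uvecE fct_sumE.
apply: continuous_big => [|i _ x]; first exact: add_continuous.
by apply: continuousZr_tmp; exact: coord_continuous.
Qed.

(** The scalar square of [uvec x]. A power of [uvec x] is thus a power of [rho x] times [uvec x] or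
    1, and no noncommutative product rule arises. *)
Let rho x := - sqnorm (vecpart x).

Lemma is_derive_rho x y :
  is_derive x y rho (- \sum_i (2 * x 0 (lift ord0 i) * y 0 (lift ord0 i))).
Proof.
have -> : rho = - \sum_(i < n) ((fun z : 'rV[R]_n.+1 => z 0 (lift ord0 i)) ^+ 2).
  apply/funext => z; rewrite /rho /sqnorm fctE fct_sumE; congr (- _).
  by apply: eq_bigr => i _; rewrite mxE.
apply: is_deriveN; apply: is_derive_sum => i.
apply: is_derive_eq (is_deriveX 2 (is_derive_coord x y (lift ord0 i))) _.
by rewrite expr1.
Qed.

Lemma rho_continuous : continuous rho.
Proof.
have -> : rho = fun x => - \sum_i (x 0 (lift ord0 i)) ^+ 2.
  apply/funext => z; congr (- _).
  by apply: eq_bigr => i _; rewrite mxE.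
move=> x; apply: continuousN; move: x.
apply: continuous_big => [|i _ x]; first exact: add_continuous.
have c1 : {for x, continuous (fun z : 'rV[R]_n.+1 => z 0 (lift ord0 i))}.
  exact: coord_continuous.
exact: (continuous_comp c1 (@exprn_continuous R 2 _)).
Qed.

Let vo (j : nat) x : Cl := if odd j then uvec x else 1.

Let uvec_expr x (j : nat) : uvec x ^+ j = rho x ^+ j./2 *: vo j x.
Proof. exact: vec_expr. Qed.

Let drho x y := - \sum_i (2 * x 0 (lift ord0 i) * y 0 (lift ord0 i)).

Definition uvec_expr_deriv (j : nat) y x : Cl :=
  ((j./2)%:R * rho x ^+ (j./2).-1 * drho x y) *: vo j x +
  rho x ^+ j./2 *: (if odd j then uvec y else 0).

Lemma is_derive_uvec_expr (j : nat) x y :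
  is_derive x y (fun z => uvec z ^+ j) (uvec_expr_deriv j y x).
Proof.
have -> : (fun z => uvec z ^+ j) = fun z => (rho ^+ j./2) z *: vo j z.
  by apply/funext => z; rewrite uvec_expr !fctE.
have dvo : is_derive x y (vo j) (if odd j then uvec y else 0).
  by rewrite /vo; case: (odd j); [exact: is_derive_uvec | exact: is_derive_cst].
apply: is_derive_eq (is_derive_scale (is_deriveX j./2 (is_derive_rho x y)) dvo) _.
by rewrite !fctE.
Qed.

Let rho_expr_continuous (e : nat) : continuous (fun x => rho x ^+ e).
Proof. by apply: expr_continuous_fun; exact: rho_continuous. Qed.

Let vo_continuous (j : nat) : continuous (vo j).
Proof.
by rewrite /vo; case: (odd j); [exact: uvec_continuous | exact: cst_continuous].
Qed.

Lemma uvec_expr_continuous (j : nat) : continuous (fun x => uvec x ^+ j : Cl).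
Proof.
have -> : (fun x => uvec x ^+ j : Cl) = fun x => rho x ^+ j./2 *: vo j x.
  by apply/funext => x; rewrite uvec_expr.
exact: scaler_continuous_fun.
Qed.

Lemma uvec_expr_deriv_continuous (j : nat) y : continuous (uvec_expr_deriv j y).
Proof.
have cdrho : continuous (drho ^~ y).
  move=> x; apply: continuousN; move: x.
  apply: continuous_big => [|i _]; first exact: add_continuous.
  apply: mulr_continuous; last exact: cst_continuous.
  by apply: mulr_continuous; [exact: cst_continuous | exact: coord_continuous].
have c1 : continuous (fun x => (j./2)%:R * rho x ^+ (j./2).-1 * drho x y).
  apply: mulr_continuous cdrho; apply: mulr_continuous => //.
  exact: cst_continuous.
have c2 : continuous (fun x => rho x ^+ j./2 *: (if odd j then uvec y else 0)).
  by apply: scaler_continuous_fun => //; exact: cst_continuous.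
move=> x; exact: cvgD (scaler_continuous_fun c1 (@vo_continuous j) (x := x)) (c2 x).
Qed.

Lemma uvec_expr_deriv_real (j : nat) x :
  uvec_expr_deriv j (delta_mx 0 ord0) x = 0.
Proof.
rewrite /uvec_expr_deriv /drho big1 ?oppr0 ?mulr0 ?scale0r ?add0r => [|i _].
  by rewrite delta_pt0 uvec_pt vec0 if_same scaler0.
by rewrite delta_pt0 mxE liftK /= mxE mulr0.
Qed.

(** Differentiating the power of [rho] yields [- 2 * j./2]; for odd [j] the remaining factor adds
    the sum of the squares of the generators, [- n]. *)
Lemma dirac_uvec_expr (j : nat) x :
  \sum_(i < n) gen R i * uvec_expr_deriv j (delta_mx 0 (lift ord0 i)) x =
  - radial_weight (n%:R - 1) j *: uvec x ^+ j.-1.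
Proof.
have drhoE i : drho x (delta_mx 0 (lift ord0 i)) = - 2 * x 0 (lift ord0 i).
  rewrite /drho (bigD1 i) //= mxE !eqxx mulr1 big1 ?addr0 ?mulNr // => l /negPf li.
  by rewrite mxE (inj_eq (@lift_inj _ ord0)) li andbF mulr0.
pose c := (j./2)%:R * rho x ^+ (j./2).-1 * - 2.
have -> : \sum_(i < n) gen R i * uvec_expr_deriv j (delta_mx 0 (lift ord0 i)) x =
    c *: (uvec x * vo j x) - (n%:R *+ odd j * rho x ^+ j./2) *: 1.
  rewrite /uvec_expr_deriv; under eq_bigr => i _.
    rewrite drhoE delta_ptS uvec_pt vec_delta mulrDr -!(scalerAr _ (gen R i)); over.
  rewrite big_split /=; congr (_ + _).
    rewrite /uvec /vec mulr_suml scaler_sumr; apply: eq_bigr => i _.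
    rewrite mxE -[_ *: gen R i * _]scalerAl [RHS]scalerA; congr (_ *: _).
    by rewrite /c; ring.
  case: (odd j); last first.
    rewrite mulr0n mul0r scale0r oppr0 big1 // => i _.
    by rewrite mulr0 scaler0.
  under eq_bigr do rewrite gen_sqr scalerN.
  by rewrite sumrN sumr_const card_ord -scaler_nat scalerA mulr1n.
have cE (a : nat) : a%:R * rho x ^+ a.-1 * rho x = a%:R * rho x ^+ a.
  by case: a => [|a]; rewrite ?mul0r // -mulrA -exprSr.
rewrite /vo /radial_weight uvec_expr /c; case oddj: (odd j).
  have jE : j.-1 = (j./2).*2.
    by rewrite -{1}(odd_double_half j) oddj.
  have jR : j%:R = 1 + 2 * (j./2)%:R :> R.
    by rewrite -{1}(odd_double_half j) oddj natrD -mul2n natrM.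
  rewrite jE /vo odd_double doubleK vec_sqr -/(rho x) !scalerA -scalerBl.
  congr (_ *: _); rewrite !mulr1n jR.
  have -> : (j./2)%:R * rho x ^+ (j./2).-1 * - 2 * rho x =
    - 2 * ((j./2)%:R * rho x ^+ (j./2).-1 * rho x) by ring.
  by rewrite cE; ring.
have jR : j%:R = 2 * (j./2)%:R :> R.
  by rewrite -{1}(odd_double_half j) oddj add0n -mul2n natrM.
rewrite mulr1 !mulr0n mul0r scale0r subr0 addr0 jR.
(* For [j = 0] the truncated exponent [j.-1] is harmless since the weight is 0. *)
case: j oddj {jR cE c} => [|[|j]] //= oddj.
  by rewrite !mul0r !mulr0 oppr0 !scale0r.
rewrite negbK in oddj; rewrite /vo /= uphalf_half oddj add0n.
by rewrite scalerA; congr (_ *: _); ring.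
Qed.

End AppellDerivatives.

(** The space is the union of the lines through the origin, each an image of the real line. *)
Lemma connected_setT {R : realType} (V : normedModType R) : connected [set: V].
Proof.
have -> : [set: V] = \bigcup_(v in [set: V]) ((fun t : R => t *: v) @` setT).
  by apply/seteqP; split=> // v _; exists v => //; exists 1; rewrite ?scale1r.
apply: bigcup_connected; first by exists 0 => v _; exists 0; rewrite ?scale0r.
move=> v _; apply: connected_continuous_connected.
  by apply/connected_intervalP => a b.
exact/continuous_subspaceT/scalel_continuous.
Qed.

(** * Monogenicity and the extension property of the Clifford-Appell polynomials *)

Section AppellMonogenic.
Context {R : realType} {n : nat}.
Hypothesis n0 : (0 < n)%N.
Notation Cl := (clifford R n).
Variable k : nat.
Implicit Types (x y : 'rV[R]_n.+1).

Let d j : R := (appell_poly n k)`_j.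

Lemma appell_real t : appell k (pt t 0) = (t ^+ k)%:A :> Cl.
Proof.
rewrite appell_expansion big_ord_recl big1 ?addr0.
  by rewrite appell_poly_coef0 // mul1r subn0 repart_pt expr0.
by move=> j _; rewrite uvec_pt vec0 expr0n scaler0.
Qed.

Definition appell_deriv y x : Cl := \sum_(j < k.+1)
  ((d j * ((k - j)%:R * repart x ^+ (k - j).-1 * repart y)) *: uvec x ^+ j +
   (d j * repart x ^+ (k - j)) *: uvec_expr_deriv j y x).

Lemma is_derive_appell x y : is_derive x y (@appell R n k) (appell_deriv y x).
Proof.
have -> : @appell R n k = \sum_(j < k.+1)
    fun z => ((d j *: (@repart R n ^+ (k - j))) z *: uvec z ^+ j).
  apply/funext => z; rewrite fct_sumE appell_expansion.
  by apply: eq_bigr => j _; rewrite !fctE.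
apply: is_derive_sum => j.
apply: is_derive_eq (is_derive_scale (is_deriveZ (d j) (is_deriveX (k - j)
  (is_derive_repart x y))) (is_derive_uvec_expr j x y)) _.
by rewrite !fctE.
Qed.

Lemma appell_deriv_continuous y : continuous (appell_deriv y).
Proof.
have ct (e : nat) : continuous (fun x => repart x ^+ e).
  by apply: expr_continuous_fun; exact: repart_continuous.
apply: continuous_big => [|j _]; first exact: add_continuous.
have c1 : continuous (fun x =>
    (d j * ((k - j)%:R * repart x ^+ (k - j).-1 * repart y)) *: uvec x ^+ j).
  apply: scaler_continuous_fun; last exact: uvec_expr_continuous.
  apply: mulr_continuous; first exact: cst_continuous.
  apply: mulr_continuous; last exact: cst_continuous.
  by apply: mulr_continuous => //; exact: cst_continuous.
have c2 : continuous (fun x =>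
    (d j * repart x ^+ (k - j)) *: uvec_expr_deriv j y x).
  apply: scaler_continuous_fun; last exact: uvec_expr_deriv_continuous.
  by apply: mulr_continuous => //; exact: cst_continuous.
by move=> x; exact: cvgD (c1 x) (c2 x).
Qed.

Lemma C1_on_appell U : C1_on U (@appell R n k).
Proof.
move=> i x _; split; first by case: (is_derive_appell x (delta_mx 0 i)).
have -> : (fun y => 'D_(delta_mx 0 i) (@appell R n k) y) =
    appell_deriv (delta_mx 0 i).
  by apply/funext => y; have /@derive_val := is_derive_appell y (delta_mx 0 i).
exact: appell_deriv_continuous.
Qed.

(** The real derivative loses the index [k], the Dirac part loses the index 0, where the weight
    vanishes; after a shift the terms cancel by [appell_poly_coefS]. *)
Lemma cauchy_riemann_appell x : cauchy_riemann (@appell R n k) x = 0.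
Proof.
have DE y : 'D_y (@appell R n k) x = appell_deriv y x.
  by have /@derive_val := is_derive_appell x y.
rewrite /cauchy_riemann DE; under eq_bigr do rewrite DE.
have -> : appell_deriv (delta_mx 0 ord0) x = \sum_(j < k)
    (d j * (k%:R - j%:R) * repart x ^+ (k - j.+1)) *: uvec x ^+ j.
  rewrite /appell_deriv big_ord_recr /= subnn !mul0r mulr0 scale0r add0r.
  rewrite uvec_expr_deriv_real scaler0 addr0; apply: eq_bigr => -[j /= jk] _.
  rewrite uvec_expr_deriv_real scaler0 addr0 delta_pt0 repart_pt mulr1 subnS.
  by rewrite natrB ?(ltnW jk) // mulrA.
have -> : \sum_(i < n) gen R i * appell_deriv (delta_mx 0 (lift ord0 i)) x =
    \sum_(j < k.+1) (- (radial_weight (n%:R - 1) j * d j) *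
      repart x ^+ (k - j)) *: uvec x ^+ j.-1.
  rewrite /appell_deriv; under eq_bigr do rewrite mulr_sumr.
  rewrite exchange_big; apply: eq_bigr => j _ /=.
  under eq_bigr => i _.
    rewrite delta_ptS repart_pt !mulr0 scale0r add0r -delta_ptS.
    rewrite -(scalerAr _ (gen R i)); over.
  rewrite -scaler_sumr dirac_uvec_expr scalerA; congr (_ *: _); ring.
rewrite big_ord_recl /radial_weight mulr0n addr0 mul0r oppr0 mul0r scale0r add0r.
rewrite -big_split big1 // => -[j /= jk] _; rewrite /bump /= add1n.
rewrite -scalerDl -/(radial_weight _ j.+1) appell_poly_coefS; apply/eqP;
  rewrite scaler_eq0; apply/orP; left; apply/eqP.
by rewrite -/(d j) mulNr mulrC [d j * _]mulrC mulrC subrr.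
Qed.

Lemma axial_form_appell U : axial_form U (@appell R n k).
Proof.
(* Even powers go to [A], odd powers to [B], whose additional factor [v] offsets the division by the
   norm. *)
pose c (j : nat) u v : R := d j * u ^+ (k - j) * (- v ^+ 2) ^+ j./2.
exists (fun u v => \sum_(j < k.+1 | ~~ odd j) (c j u v)%:A).
exists (fun u v => \sum_(j < k.+1 | odd j) (c j u v * v)%:A).
split=> [u v|u v|x _ r].
- by apply: eq_bigr => j _; rewrite /c sqrrN.
- by rewrite -sumrN; apply: eq_bigr => j _; rewrite /c sqrrN mulrN scaleNr.
(* At a real point both sides are 0, since the vector part vanishes there. *)
have rE : r *: (r^-1 *: uvec x) = uvec x.
  rewrite scalerA; have [r0|r0] := eqVneq r 0; last by rewrite divff // scale1r.
  have w0 : vecpart x = 0.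
    have := enorm_sqr (vecpart x); rewrite -/r r0 expr0n /= => /esym/eqP.
    rewrite psumr_eq0 => [/allP w0|i _]; last exact: sqr_ge0.
    apply/rowP => i; have := w0 i (mem_index_enum _).
    by rewrite /= sqrf_eq0 => /eqP ->; rewrite mxE.
  by rewrite /uvec w0 vec0 scaler0.
rewrite appell_expansion (bigID (fun j : 'I_k.+1 => odd j)) /= addrC; congr (_ + _).
  apply: eq_bigr => j /negPf oj.
  by rewrite /uvec vec_expr oj -enorm_sqr scalerA.
rewrite mulr_sumr; apply: eq_bigr => j oj.
rewrite /uvec vec_expr oj -enorm_sqr -/r scalerA -/(uvec x) -[in LHS]rE.
by rewrite -scalerAr mulr1 scalerA.
Qed.

Lemma appell_series x :
  series (fun j => uvec x ^+ j * (d j * repart x ^+ (k - j))%:A) @ \oo -->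
  appell k x.
Proof.
apply: cvg_near_cst; near=> N; have kN : (k.+1 <= N)%N.
  by near: N; exact: nbhs_infty_ge.
rewrite appell_expansion /series /= (big_cat_nat (leq0n k.+1) kN) /=.
rewrite (_ : \sum_(k.+1 <= j < N) _ = 0).
  by rewrite addr0 big_mkord; apply: eq_bigr => j _; rewrite -scalerAr mulr1.
rewrite big_nat big1 // => j /andP[kj _].
rewrite /d /appell_poly coef_sum big1 ?mul0r ?scale0r ?mulr0 // => -[s /= sk] _.
rewrite coefZ [_`_j]nth_default ?mulr0 //; apply: leq_trans kj.
by apply: leq_trans (size_appell_factor _ _) _; rewrite subnK // -ltnS.
Unshelve. all: by end_near. Qed.

Lemma axially_monogenic_appell : axially_monogenic setT (@appell R n k).
Proof.
split; [split|exact: C1_on_appell|by move=> x _; exact: cauchy_riemann_appell|].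
- by [].
- split.
  + exact: openT.
  + exact: connected_setT.
  + by exists 0.
  + by move=> I _; exact: connected_setT.
- exact: axial_form_appell.
Qed.

Lemma is_GCK_appell : is_GCK setT (fun t => (t ^+ k)%:A) (@appell R n k).
Proof.
split.
(* The Taylor coefficients at [a] come from the binomial expansion of [((t - a) + a) ^+ k]. *)
- move=> a _; exists (fun j => ('C(k, j)%:R * a ^+ (k - j))%:A).
  near=> t; apply: cvg_near_cst; near=> N.
  have kN : (k.+1 <= N)%N by near: N; exact: nbhs_infty_ge.
  rewrite /series /= (big_cat_nat (leq0n k.+1) kN) /=.
  rewrite (_ : \sum_(k.+1 <= j < N) _ = 0); last first.
    rewrite big_nat big1 // => j /andP[kj _].
    by rewrite bin_small // mul0r scale0r scaler0.
  rewrite addr0 big_mkord -[t in RHS](subrK a) [_ - _ + _]addrC exprDn scaler_suml.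
  apply: eq_bigr => j _; rewrite scalerA; congr (_ *: _).
  by rewrite -[RHS]mulr_natr mulrCA mulrC [a ^+ _ * _]mulrC.
- exact: axially_monogenic_appell.
- exists (fun j t => (d j * t ^+ (k - j))%:A) => x _; exact: appell_series.
- by move=> t _; exact: appell_real.
Unshelve. all: by end_near. Qed.

End AppellMonogenic.

(** The defining conditions are linear, so the difference is axially monogenic, has an expansion in
    powers of the vector part and vanishes on the real line. *)
Lemma is_GCK_unique (R : realType) (n : nat) (f0 : R -> clifford R n.+1)
    (F G : 'rV[R]_n.+2 -> clifford R n.+1) :
  is_GCK setT f0 F -> is_GCK setT f0 G -> F = G.
Proof.
move=> [_ [_ dF crF [A [B [Ae Bo FE]]]] [f fF] F0].
move=> [_ [_ dG crG [A' [B' [Ae' Bo' GE]]]] [g gG] G0].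
apply/funext => x; apply/eqP; rewrite -subr_eq0; apply/eqP.
have dF1 i y := (dF i y I).1; have dG1 i y := (dG i y I).1.
apply: (@axially_monogenic_uniqueness R n (fun y => F y - G y) _ _ _
  (fun j t => f j t - g j t)).
- by move=> i y; apply: derivableB.
- exists (fun u v => A u v - A' u v), (fun u v => B u v - B' u v).
  split=> [u v|u v|y _ r]; first by rewrite Ae Ae'.
    by rewrite Bo Bo' opprD.
  by rewrite FE // GE // -/r mulrBr opprD addrACA.
- move=> y; rewrite /cauchy_riemann.
  have DB v : derivable F y v -> derivable G y v ->
    'D_v (fun z => F z - G z) y = 'D_v F y - 'D_v G y by exact: deriveB.
  rewrite DB //; under eq_bigr do rewrite DB // mulrBr.
  rewrite sumrB addrACA -opprD -[X in X - _ = _]/(cauchy_riemann F y).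
  by rewrite -/(cauchy_riemann G y) crF // crG // subr0.
- move=> y; apply: cvg_trans (cvgB (fF y I) (gG y I)).
  apply: near_eq_cvg; near=> N; rewrite /series /= -[LHS]sumrB.
  by apply: eq_bigr => j _; rewrite mulrBr.
- by move=> t; rewrite F0 // G0 // subrr.
Unshelve. all: by end_near. Qed.

Theorem lemma5p5 (R : realType) (n : nat) (n_odd : odd n) (l k : nat)
    (x : 'rV[R]_n.+1) :
  GCK_product [set: 'rV[R]_n.+1]%classic (appell l) (appell k) x =
  appell (k + l) x.
Proof.
(* Oddness excludes dimension 0, so a first generator exists. *)
case: n n_odd x => // n _ x; rewrite /GCK_product /GCK.
have -> : (fun t => appell l (pt t 0) * appell k (pt t 0)) =
    (fun t => (t ^+ (k + l))%:A) :> (R -> clifford R n.+1).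
  apply/funext => t; rewrite !appell_real // -scalerAl mul1r scalerA -exprD.
  by rewrite addnC.
have appellP := @is_GCK_appell R n.+1 (ltn0Sn n) (k + l).
(* Either the choice returns some extension, which uniqueness identifies, or none exists, which
   [appellP] refutes. *)
case: xgetP => [F _ FP|/(_ (@appell R n.+1 (k + l)))]; last by [].
by rewrite (is_GCK_unique FP appellP).
Qed.
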